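(* Let $u,v,w_1,w_2$ be weights on $\mathbb{R}^n$, let $\mathcal{F}$ be a family of extrapolation pairs, and let $\Phi$ be a Young function or $\Phi(t)=t$. Suppose that $\mathbb{X}_u$ and $\mathbb{X}_v$ are Banach function spaces over $(\mathbb{R}^n,u\,dx)$ and $(\mathbb{R}^n,v\,dx)$ respectively, such that $\mathbb{Y}_u=\mathbb{X}_u^{\frac1{p_0}}$ and $\mathbb{Y}_v=\mathbb{X}_v^{\frac1{p_0}}$ are Banach function spaces for some $p_0\in(0,\infty)$. Assume that there is a constant $C$ with $$\|(M_\Phi f)\,w_2^{-p_0}v^{-1}\|_{\mathbb{Y}_v'}\le C\,\|f\,w_1^{-p_0}u^{-1}\|_{\mathbb{Y}_u'}\qquad\text{for all measurable } f.$$ If there is a constant $C$ such that for every weight $w_0$, $$\|f\|_{L^{p_0}(w_0)}\le C\,\|g\|_{L^{p_0}(M_\Phi w_0)},\qquad (f,g)\in\mathcal{F},$$ then there is a constant $C$ such that $$\|fw_1\|_{\mathbb{X}_u}\le C\,\|gw_2\|_{\mathbb{X}_v},\qquad (f,g)\in\mathcal{F}.$$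
   Context: A weight on $\mathbb{R}^n$ is a measurable $w$ with $0<w<\infty$ a.e.; $w(E)=\int_E w\,dx$; $\|f\|_{L^p(w)}=(\int|f|^p w\,dx)^{1/p}$. A Young function is a continuous, convex, strictly increasing $\Phi:[0,\infty)\to[0,\infty)$ with $\Phi(t)/t\to0$ as $t\to0^+$ and $\Phi(t)/t\to\infty$ as $t\to\infty$. For a cube $Q$, $\|f\|_{\Phi,Q}=\inf\{\lambda>0:\frac1{|Q|}\int_Q\Phi(|f|/\lambda)\,dx\le1\}$ and $M_\Phi f(x)=\sup_{Q\ni x}\|f\|_{\Phi,Q}$; for $\Phi(t)=t$ this is the Hardy–Littlewood maximal operator $Mf(x)=\sup_{Q\ni x}\frac1{|Q|}\int_Q|f|$. A family of extrapolation pairs is a collection of pairs $(f,g)$ of nonnegative measurable functions on $\mathbb{R}^n$. Let $\mathbb{M}$ be the set of (classes of) measurable functions on $\mathbb{R}^n$. For a weight $\omega$, a Banach function space (BFS) over $(\mathbb{R}^n,\omega\,dx)$ is $\mathbb{X}_\omega=\{f\in\mathbb{M}:\|f\|_{\mathbb{X}_\omega}<\infty\}$, where $\|\cdot\|=\|\cdot\|_{\mathbb{X}_\omega}:\mathbb{M}\to[0,\infty]$ satisfies: (1) $\|f\|=\||f|\|$, and $\|f\|=0$ iff $f=0$ a.e.; (2) $\|f+g\|\le\|f\|+\|g\|$; (3) $\|\lambda f\|=|\lambda|\|f\|$; (4) $|f|\le|g|$ a.e. implies $\|f\|\le\|g\|$; (5) $|f_j|\uparrow|f|$ a.e. implies $\|f_j\|\uparrow\|f\|$;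 (6) if $\omega(E)<\infty$ then $\|\mathbf{1}_E\|<\infty$ and $\int_E|f|\,\omega\,dx\le C_E\|f\|$. The associate space $\mathbb{X}_\omega'$ has norm $\|f\|_{\mathbb{X}_\omega'}=\sup\{\int|fg|\,\omega\,dx:\|g\|_{\mathbb{X}_\omega}\le1\}$. For $0<p<\infty$, $\mathbb{X}_\omega^p$ is defined by $\|f\|_{\mathbb{X}_\omega^p}:=\||f|^p\|_{\mathbb{X}_\omega}^{1/p}$. Functions not in a space have norm $+\infty$. *)

(* Defs.v *)
From HB Require Import structures.
From mathcomp Require Import all_boot all_order all_algebra.
From mathcomp Require Import all_classical all_reals all_analysis.
From mathcomp Require Import measurable_realfun.

Set Implicit Arguments.
Unset Strict Implicit.
Unset Printing Implicit Defensive.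

Import Order.TTheory GRing.Theory Num.Theory.
Import numFieldNormedType.Exports.

Local Open Scope classical_set_scope.
Local Open Scope ring_scope.
(* Only the values of Phi on [0, +oo[ matter. *)
Record Young (R : realType) (Phi : R -> R) : Prop := {
  Young_ge0 : forall t, 0 <= t -> 0 <= Phi t ;
  Young_continuous : {within `[0, +oo[, continuous Phi} ;
  Young_convex : convex_function (`[0, +oo[%classic : set R^o) Phi ;
  Young_increasing : {in `[0, +oo[ &, {homo Phi : s t / s < t}} ;
  Young_at0 : Phi t / t @[t --> 0^'+] --> (0 : R) ;
  Young_aty : Phi t / t @[t --> +oo] --> +oo }.

Local Open Scope ereal_scope.

Section lebesgue_cons.
Context {R : realType}.
Local Notation TR := (measurableTypeR R).
Variables (n : nat) (m : {sigma_finite_measure set (n.-tuple TR) -> \bar R}).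

Let cons_pair (xt : TR * n.-tuple TR) : n.+1.-tuple TR := cons_tuple xt.1 xt.2.

Let measurable_cons_pair : measurable_fun [set: _] cons_pair.
Proof. exact: measurable_cons measurable_fst measurable_snd. Qed.

Let split_tuple (t : n.+1.-tuple TR) : TR * n.-tuple TR :=
  (tnth t ord0, [tuple of behead t]).

Let measurable_split_tuple : measurable_fun [set: _] split_tuple.
Proof.
apply: measurable_fun_pair; [exact: measurable_tnth|exact: measurable_behead].
Qed.

Let cons_pairK : cancel cons_pair split_tuple.
Proof. by case=> x t; congr pair; apply: val_inj. Qed.

Definition lebesgue_cons : set (n.+1.-tuple TR) -> \bar R :=
  fun A => (@lebesgue_measure R \x m) [set xt : TR * n.-tuple TR | A (cons_tuple xt.1 xt.2)].

Let lebesgue_cons0 : lebesgue_cons set0 = 0.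
Proof. exact: measure0. Qed.

Let lebesgue_cons_ge0 A : 0 <= lebesgue_cons A.
Proof. exact: measure_ge0. Qed.

Let lebesgue_cons_sigma_additive : semi_sigma_additive lebesgue_cons.
Proof.
exact: (@measure_semi_sigma_additive _ _ _
  (measure_function_pushforward__canonical__measure_function_Measure
     (@lebesgue_measure R \x m) measurable_cons_pair)).
Qed.

HB.instance Definition _ := isMeasure.Build _ _ _ lebesgue_cons
  lebesgue_cons0 lebesgue_cons_ge0 lebesgue_cons_sigma_additive.

Let lebesgue_cons_sigma_finite : sigma_finite setT lebesgue_cons.
Proof.
have /sigma_finiteP[F [TF ndF Foo]] := sigma_finiteT (@lebesgue_measure R).
have /sigma_finiteP[G [TG ndG Goo]] := sigma_finiteT m.
exists (fun k => split_tuple @^-1` (F k `*` G k)).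
  rewrite -preimage_bigcup (_ : \bigcup_k _ = setT) ?preimage_setT//.
  apply/seteqP; split=> // -[x t] _.
  have [i _ Fx] : (\bigcup_i F i) x by rewrite -TF.
  have [j _ Gt] : (\bigcup_j G j) t by rewrite -TG.
  exists (maxn i j) => //; split => /=.
  - by move: x Fx; exact/subsetPset/ndF/leq_maxl.
  - by move: t Gt; exact/subsetPset/ndG/leq_maxr.
move=> k; have [mF Fk] := Foo k; have [mG Gk] := Goo k; split.
  rewrite -[X in measurable X]setTI; apply: measurable_split_tuple => //.
  exact: measurableX.
rewrite /lebesgue_cons (_ : [set xt | _] = F k `*` G k); last first.
  have sc : split_tuple \o cons_pair = id by apply/funext => xt; exact: cons_pairK.
  rewrite -[RHS]preimage_id -sc; exact: comp_preimage.
by rewrite product_measure1E// lte_mul_pinfty// ge0_fin_numE.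
Qed.

HB.instance Definition _ := Measure_isSigmaFinite.Build _ _ _ lebesgue_cons
  lebesgue_cons_sigma_finite.

End lebesgue_cons.

(* Lebesgue measure on the Borel sets of R^n: the n-fold product measure. *)
Fixpoint borel_lebesgue (R : realType) (n : nat) :
    {sigma_finite_measure set (n.-tuple (measurableTypeR R)) -> \bar R} :=
  match n with
  | 0 => dirac [tuple]
  | k.+1 => lebesgue_cons (borel_lebesgue R k)
  end.

Lemma measurable_box (R : realType) (n : nat)
    (A : 'I_n -> set (measurableTypeR R)) :
  (forall i, measurable (A i)) ->
  measurable [set t : n.-tuple (measurableTypeR R) | forall i, A i (tnth t i)].
Proof.
move=> mA; rewrite (_ : [set t | _] =
  \bigcap_(i in [set: 'I_n]) ((fun t => tnth t i) @^-1` A i)).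
  apply: fin_bigcap_measurable => // i _.
  by rewrite -[X in measurable X]setTI; exact: measurable_tnth.
by apply/seteqP; split=> t At i *; exact: At.
Qed.

Lemma borel_lebesgue_box (R : realType) (n : nat)
    (A : 'I_n -> set (measurableTypeR R)) :
  (forall i, measurable (A i)) ->
  borel_lebesgue R n [set t | forall i, A i (tnth t i)] =
    \prod_(i < n) lebesgue_measure (A i).
Proof.
elim: n A => [|n IH] A mA /=.
  by rewrite big_ord0 /dirac indicE mem_set//= => -[].
rewrite big_ord_recl -IH//.
rewrite -product_measure1E; [|exact: mA|]; last first.
  exact: (@measurable_box R n (fun i => A (lift ord0 i)) (fun i => mA _)).
rewrite /lebesgue_cons; congr (_ _).
apply/seteqP; split=> -[x t]/=.
  move=> Axt; split; first exact: (Axt ord0).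
  by move=> i; have := Axt (lift ord0 i); rewrite tnthS.
by move=> [Ax At] i; case: (unliftP ord0 i) => [j|] -> //; rewrite tnthS.
Qed.

(* The product is completed, so that measurable functions on Rn are the
   Lebesgue-measurable ones. *)
Definition Rn (R : realType) (n : nat) :=
  caratheodory_type (borel_lebesgue R n)^*%mu.
HB.instance Definition _ (R : realType) (n : nat) := Measurable.on (Rn R n).

Definition lebesgue (R : realType) (n : nat) : {measure set (Rn R n) -> \bar R} :=
  @completed_measure_extension _ _ _ (borel_lebesgue R n).

Section definitions.
Context {R : realType} {n : nat}.
Local Notation mu := (lebesgue R n).
Implicit Types (f g w : Rn R n -> \bar R) (Q E : set (Rn R n)) (Phi : R -> R).

(* Open, with sides parallel to the axes; closed or half-open cubes give the
   same supremum in maximal. *)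
Definition cube (a : Rn R n) (r : R) : set (Rn R n) :=
  [set x | forall i : 'I_n, (tnth a i < tnth x i < tnth a i + r)%R].

Lemma lebesgue_cube (a : Rn R n) (r : R) : (0 < r)%R ->
  lebesgue R n (cube a r) = (r ^+ n)%:E.
Proof.
move=> r0.
pose A i : set (measurableTypeR R) := `]tnth a i, (tnth a i + r)%R[%classic.
have mA i : measurable (A i) by exact: measurable_itv.
have -> : cube a r = [set t | forall i, A i (tnth t i)].
  by apply/seteqP; split=> t /= + i => /(_ i); rewrite /A/= in_itv.
transitivity (borel_lebesgue R n [set t | forall i, A i (tnth t i)]).
  by apply: measurable_mu_extE; exact: (@measurable_box R n A mA).
rewrite (@borel_lebesgue_box R n A mA) (eq_bigr (fun=> r%:E)) => [|i _].
  by rewrite prodEFin big_const_ord iter_mulr mulr1.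
rewrite /A lebesgue_measure_itv/= lte_fin ltrDl r0 -EFinD.
by rewrite addrAC subrr add0r.
Qed.

Definition is_cube Q := exists a r, (0 < r)%R /\ Q = cube a r.

Definition weight w :=
  measurable_fun setT w /\ {ae mu, forall x, 0 < w x < +oo}.

Definition wmeasure w E : \bar R := \int[mu]_(x in E) w x.

Definition wLnorm (p : R) w f : \bar R :=
  (\int[mu]_x (`|f x| `^ p * w x)) `^ p^-1.

(* er_map extends Phi by Phi(+oo) = +oo. *)
Definition luxemburg Phi f Q : \bar R :=
  ereal_inf [set l%:E | l in [set l : R | (0 < l)%R /\
    (mu Q)^-1 * \int[mu]_(x in Q) er_map Phi (`|f x| / l%:E) <= 1]].

Definition maximal Phi f (x : Rn R n) : \bar R :=
  ereal_sup [set luxemburg Phi f Q | Q in [set Q | is_cube Q /\ Q x]].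

(* A Banach function space over (R^n, w dx) is given by its norm N; functions
   stand for their a.e. classes, as BFS_le makes N invariant under a.e.
   equality. In BFS_add, +oo + -oo is -oo in MathComp, whose absolute value
   +oo still obeys |f + g| <= |f| + |g|. *)
Record BFS w (N : (Rn R n -> \bar R) -> \bar R) : Prop := {
  BFS_ge0 : forall f, measurable_fun setT f -> 0 <= N f ;
  BFS_abs : forall f, measurable_fun setT f -> N f = N (fun x => `|f x|) ;
  BFS_eq0 : forall f, measurable_fun setT f ->
    (N f = 0 <-> {ae mu, forall x, f x = 0}) ;
  BFS_add : forall f g, measurable_fun setT f -> measurable_fun setT g ->
    N (fun x => f x + g x) <= N f + N g ;
  BFS_scale : forall (l : R) f, measurable_fun setT f ->
    N (fun x => l%:E * f x) = `|l|%:E * N f ;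
  BFS_le : forall f g, measurable_fun setT f -> measurable_fun setT g ->
    {ae mu, forall x, `|f x| <= `|g x|} -> N f <= N g ;
  BFS_fatou : forall (F_ : nat -> Rn R n -> \bar R) f,
    (forall j, measurable_fun setT (F_ j)) -> measurable_fun setT f ->
    {ae mu, forall x, nondecreasing_seq (fun j => `|F_ j x|) /\
                      `|F_ j x| @[j --> \oo] --> `|f x|} ->
    nondecreasing_seq (fun j => N (F_ j)) /\ N (F_ j) @[j --> \oo] --> N f ;
  BFS_indic : forall E, measurable E -> wmeasure w E < +oo ->
    N (fun x => (\1_E x)%:E) < +oo ;
  BFS_int : forall E, measurable E -> wmeasure w E < +oo ->
    exists C : R, (0 < C)%R /\ forall f, measurable_fun setT f ->
      \int[mu]_(x in E) (`|f x| * w x) <= C%:E * N f }.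

Definition associate w (N : (Rn R n -> \bar R) -> \bar R) f : \bar R :=
  ereal_sup [set \int[mu]_x (`|f x * g x| * w x) |
    g in [set g | measurable_fun setT g /\ N g <= 1]].

Definition powernorm (N : (Rn R n -> \bar R) -> \bar R) (p : R) f : \bar R :=
  (N (fun x => `|f x| `^ p)) `^ p^-1.

Definition extrapolation_family
    (F : set ((Rn R n -> \bar R) * (Rn R n -> \bar R))) :=
  forall f g, F (f, g) ->
    [/\ measurable_fun setT f, measurable_fun setT g,
        forall x, 0 <= f x & forall x, 0 <= g x].

End definitions.

(* Main.v *)
Require Import Defs.
From HB Require Import structures.
From mathcomp Require Import all_boot all_order all_algebra.
From mathcomp Require Import all_classical all_reals all_analysis.
From mathcomp Require Import measurable_realfun ring lra.

(** The theorem is extrapolation by duality. Write [Y] for the [1/p0]-th power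
    of [X], so that [Xu (f w1) ^ p0 = Yu (|f w1| ^ p0)]. If [Yu] is the dual of
    its associate space, this quantity is the supremum of the integrals of
    [|f w1| ^ p0 psi u] over the nonnegative [psi] in the unit ball of [Yu'].
    Such an integral is the [p0]-th power of the norm of [f] in [L^p0(w0)],
    where [w0 = psi w1 ^ p0 u]. The extrapolation hypothesis bounds it by the
    integral of [g ^ p0 * maximal Phi w0], which is the pairing of
    [|g w2| ^ p0] with [maximal Phi w0 * w2 ^ - p0 * v ^-1] against [v dx].
    By Hoelder's inequality ([hoelder_associate]) it is at most
    [Xv (g w2) ^ p0] times a norm in [Yv'], and the boundedness of the maximal
    operator brings this norm back to that of [w0 w1 ^ - p0 u ^-1 = psi] in
    [Yu'], which is at most a constant.

    Three points need work.

    - The duality [Yu'' = Yu] (the Lorentz-Luxemburg theorem), in the form of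
      [separation] and [BFS_le_dual]. A function of norm greater than 1 is
      truncated to a bounded [f] carried by a set [E] on which the weight is
      bounded above and below and Lebesgue measure is finite. By the Fatou
      property the unit ball is closed in [L^2(E)], so [f] has a nearest point
      [g0] in it, and the variational inequality of a projection onto a convex
      set says that [f - g0] separates [f] from the ball. The nearest point is
      obtained without the completeness of [L^2]: by the parallelogram
      identity a minimising sequence [g_k] is Cauchy in [L^1], so that its
      lower envelopes [inf_(k >= n) g_k] are also minimising; they increase
      and stay in the ball, which is closed under increasing limits.

    - The function [psi] must be positive almost everywhere for [w0] to be a
      weight. An element of the unit ball of [Yu'] that is positive almost
      everywhere ([positive_associate]) is added to it, at the cost of a
      factor 2.

    - The maximal function must be measurable for the integrals to be compared
      almost everywhere; it is lower semicontinuous, as it is a supremum over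
      open cubes ([measurable_maximal]). *)

Set Implicit Arguments.
Unset Strict Implicit.

Import Order.TTheory GRing.Theory Num.Theory.
Import numFieldNormedType.Exports.

Local Open Scope classical_set_scope.
Local Open Scope ring_scope.

(** * Measurability of the maximal function *)

Section maximal_measurable.
Context {R : realType} {n : nat}.

Lemma measurable_Rn (A : set (n.-tuple (measurableTypeR R))) :
  measurable A -> measurable (A : set (Rn R n)).
Proof.
by move=> mA; apply: sub_caratheodory; exact: sub_gen_smallest.
Qed.

Lemma measurable_cube (a : Rn R n) r : measurable (cube a r).
Proof.
pose A i : set (measurableTypeR R) := `]tnth a i, (tnth a i + r)[%classic.
have -> : cube a r = [set t | forall i, A i (tnth t i)].
  by apply/seteqP; split=> t /= + i => /(_ i); rewrite /A/= in_itv.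
by apply: measurable_Rn; apply: (@measurable_box R n A) => i; exact: measurable_itv.
Qed.

Let rational_box (q : 'I_n -> rat * rat) : set (Rn R n) :=
  [set x | forall i, ratr (q i).1 < tnth x i < ratr (q i).2].

Let measurable_rational_box q : measurable (rational_box q).
Proof.
pose A i : set (measurableTypeR R) := `]ratr (q i).1, ratr (q i).2[%classic.
have -> : rational_box q = [set t | forall i, A i (tnth t i)].
  by apply/seteqP; split=> t /= + i => /(_ i); rewrite /A/= in_itv.
by apply: measurable_Rn; apply: (@measurable_box R n A) => i; exact: measurable_itv.
Qed.

(** The union may be uncountable, but every point of an open cube lies in a box
    with rational corners inside the cube, so countably many boxes suffice. *)
Lemma measurable_bigcup_cube (G : set (set (Rn R n))) : G `<=` @is_cube R n ->
  measurable (\bigcup_(Q in G) Q).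
Proof.
move=> Gcube.
rewrite (_ : \bigcup_(Q in G) Q = \bigcup_(q in [set q : {ffun 'I_n -> rat * rat} |
    exists2 Q, G Q & rational_box q `<=` Q]) rational_box q).
  rewrite bigcup_mkcond; apply: countable_bigcupT_measurable => [|q].
    exact: countableP.
  by case: ifPn.
apply/seteqP; split => [x [Q GQ Qx]|x [q [Q GQ qQ] qx]]; last by exists Q => //; exact: qQ.
have [a [r [r0 QE]]] := Gcube _ GQ; move: Qx; rewrite QE => ax.
have /choice[q qP] i : exists q : rat * rat,
    [/\ tnth a i < ratr q.1, ratr q.1 < tnth x i,
        tnth x i < ratr q.2 & ratr q.2 < tnth a i + r].
  have /andP[h1 h2] := ax i.
  have [p] := rat_in_itvoo h1; have [p'] := rat_in_itvoo h2.
  rewrite !in_itv/= => /andP[? ?] /andP[? ?].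
  by exists (p, p').
exists [ffun i => q i]; last by move=> i; rewrite ffunE; have [_ -> -> _] := qP i.
exists Q => //; rewrite QE => y qy i.
have [h1 _ _ h2] := qP i; have := qy i; rewrite ffunE => /andP[h3 h4].
by rewrite (lt_trans h1)//= (lt_trans h4).
Qed.

(** A superlevel set of a supremum over the cubes around a point is the union
    of the cubes on which the level is exceeded. *)
Lemma measurable_maximal (Phi : R -> R) (f : Rn R n -> \bar R) :
  measurable_fun setT (maximal Phi f).
Proof.
apply: (measurability _ (ErealGenOInfty.measurableE R)) => // _ [_ [y ->] <-].
rewrite setTI (_ : _ @^-1` _ =
  \bigcup_(Q in [set Q | is_cube Q /\ (y%:E < luxemburg Phi f Q)%E]) Q).
  by apply: measurable_bigcup_cube => Q [].
apply/seteqP; split => x /=; rewrite in_itv/= andbT.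
  by move=> /ereal_sup_gt[_ [Q [cQ Qx] <-] yQ]; exists Q.
move=> [Q [cQ yQ] Qx]; apply: (lt_le_trans yQ).
by apply: ereal_sup_ubound; exists Q.
Qed.

Lemma luxemburg_ge0 (Phi : R -> R) (f : Rn R n -> \bar R) Q :
  (0 <= luxemburg Phi f Q)%E.
Proof.
by apply: le_ereal_inf_tmp => _ [l [l0 _] <-]; rewrite lee_fin ltW.
Qed.

Lemma cube_covers (x : Rn R n) : exists k : nat,
  cube [tuple (- k.+1%:R : R) | i < n] (2 * k.+1%:R) x.
Proof.
have [k kx] : exists k : nat, forall i : 'I_n, `|tnth x i| < k.+1%:R.
  have h i : exists k : nat, `|tnth x i| < k.+1%:R.
    by exists (Num.bound `|tnth x i|); rewrite (lt_le_trans (archi_boundP _))// ler_nat.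
  have /choice[k kP] := h.
  exists (\max_i k i)%N => i; rewrite (lt_le_trans (kP i))// ler_nat ltnS.
  exact: leq_bigmax.
exists k => i; rewrite tnth_mktuple.
have := kx i; rewrite ltr_norml => /andP[h1 h2]; rewrite h1/=; lra.
Qed.

Lemma maximal_ge0 (Phi : R -> R) (f : Rn R n -> \bar R) x :
  (0 <= maximal Phi f x)%E.
Proof.
have [k kx] := cube_covers x.
apply: (le_trans (luxemburg_ge0 Phi f
  (cube [tuple (- k.+1%:R : R) | i < n] (2 * k.+1%:R)))).
apply: ereal_sup_ubound; eexists; last reflexivity.
by split => //; exists [tuple (- k.+1%:R : R) | i < n], (2 * k.+1%:R).
Qed.

End maximal_measurable.

(** * Inverses and truncations of measurable functions *)

Section measurable_inverse.
Context {disp} {T : measurableType disp} {R : realType}.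

Lemma measurable_funV (f : T -> R) :
  measurable_fun setT f -> measurable_fun setT (fun x => (f x)^-1).
Proof.
move=> mf.
(* Real powers are measurable; squaring makes the base nonnegative. *)
rewrite (_ : (fun x => _) = fun x => f x * (f x * f x) `^ (-1)).
  apply: measurable_funM => //.
  have mff : measurable_fun setT (fun x => f x * f x) by exact: measurable_funM.
  exact: (measurableT_comp (measurable_powR (-1)) mff).
apply/funext => x; rewrite powR_inv1 -?expr2 ?sqr_ge0//.
have [->|f0] := eqVneq (f x) 0; first by rewrite invr0 mul0r.
by rewrite expr2 invfM mulVKf.
Qed.

Lemma measurable_funVe (f : T -> \bar R) :
  measurable_fun setT f -> measurable_fun setT (fun x => (f x)^-1)%E.
Proof.
move=> mf; rewrite (_ : (fun x => _) = fun x => if f x == 0%E then +oo%E else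
    if f x == -oo%E then -oo%E else ((fine (f x))^-1)%:E); last first.
  apply/funext => x; case: inveP => [|||r r0] //=; first by rewrite eqxx.
  - by rewrite /= invr0.
  - by rewrite eqe (negbTE r0).
apply: measurable_fun_ifT => //; first exact: measurable_fun_eqe.
apply: measurable_fun_ifT => //; first exact: measurable_fun_eqe.
by apply/measurable_EFinP/measurable_funV; apply: measurableT_comp.
Qed.

End measurable_inverse.

Section truncation.
Context {disp} {T : measurableType disp} {R : realType}.
Implicit Types f : T -> \bar R.

(** Real-valued, so that truncations can be compared in [L^2]. *)
Definition truncation f (j : nat) (x : T) : R := fine (mine `|f x| j%:R%:E)%E.

Lemma EFin_truncation f j x : ((truncation f j x)%:E = mine `|f x| j%:R%:E)%E.
Proof.
rewrite fineK// fin_numElt; apply/andP; split.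
  by rewrite (@lt_le_trans _ _ 0%E)// le_min abse_ge0 lee_fin.
by rewrite gt_min ltry orbT.
Qed.

Lemma truncation_le f j x : ((truncation f j x)%:E <= `|f x|)%E.
Proof. by rewrite EFin_truncation ge_min lexx. Qed.

Lemma truncation_btw f j x : 0 <= truncation f j x <= j%:R.
Proof. by rewrite -!lee_fin EFin_truncation le_min abse_ge0 lee_fin ler0n ge_min lexx orbT. Qed.

Lemma measurable_truncation f j :
  measurable_fun setT f -> measurable_fun setT (truncation f j).
Proof.
move=> mf; apply/measurable_EFinP.
rewrite (_ : _ \o _ = (fun x => mine `|f x| j%:R%:E)%E); last first.
  by apply/funext => x /=; rewrite EFin_truncation.
by apply: measurable_mine; [exact: measurableT_comp|exact: measurable_cst].
Qed.

Lemma truncation_nondecreasing f x : nondecreasing_seq ((truncation f) ^~ x).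
Proof.
move=> i j ij; rewrite -lee_fin !EFin_truncation le_min !ge_min lexx/=.
by rewrite lee_fin ler_nat ij orbT.
Qed.

Lemma truncation_cvg f x :
  (truncation f j x)%:E @[j --> \oo] --> (`|f x|)%E.
Proof.
under eq_fun do rewrite EFin_truncation.
have := abse_ge0 (f x); case: (`|f x|)%E => [r| |] // r0.
- apply: cvg_near_cst; near=> j.
  apply/min_idPl; rewrite lee_fin.
  rewrite lee_fin in r0; apply: (le_trans (ltW (archi_boundP r0))); rewrite ler_nat.
  by near: j; exact: nbhs_infty_ge.
- rewrite (_ : (fun j => _) = (fun j : nat => j%:R%:E)); last first.
    by apply/funext => j; apply/min_idPr; rewrite leey.
  exact/cvgenyP/cvg_id.
Unshelve. all: by end_near. Qed.

End truncation.

(** * Integrals of bounded functions over a set of finite measure *)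

Lemma cvg_seq_le {R : realType} (v : nat -> R) (l c : R) :
  v n @[n --> \oo] --> l -> (forall n, v n <= c) -> l <= c.
Proof.
move=> vl vc; rewrite -(cvg_lim _ vl)//; apply: limr_le.
  by apply/cvg_ex; exists l.
exact: nearW.
Qed.

Section bounded_integral.
Context {disp} {T : measurableType disp} {R : realType} (mu : {measure set T -> \bar R}).
Variables (E : set T) (mE : measurable E) (muE : (mu E < +oo)%E).

Definition bounded_measurable (g : T -> R) :=
  measurable_fun setT g /\ exists M, forall x, `|g x| <= M.

Lemma bounded_measurableD f g :
  bounded_measurable f -> bounded_measurable g ->
  bounded_measurable (fun x => f x + g x).
Proof.
move=> [mf [M fM]] [mg [N gN]]; split; first exact: measurable_funD.
by exists (M + N) => x; rewrite (le_trans (ler_normD _ _))// lerD.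
Qed.

Lemma bounded_measurableM f g :
  bounded_measurable f -> bounded_measurable g ->
  bounded_measurable (fun x => f x * g x).
Proof.
move=> [mf [M fM]] [mg [N gN]]; split; first exact: measurable_funM.
by exists (M * N) => x; rewrite normrM ler_pM.
Qed.

Lemma bounded_measurable_cst r : bounded_measurable (fun=> r).
Proof. by split; [exact: measurable_cst|exists `|r|]. Qed.

Lemma bounded_measurableN f :
  bounded_measurable f -> bounded_measurable (fun x => - f x).
Proof.
move=> [mf [M fM]]; split; first exact: measurableT_comp.
by exists M => x; rewrite normrN.
Qed.

Ltac bounded_measurability := repeat first
  [ assumption | apply: bounded_measurable_cst | apply: bounded_measurableN
  | apply: bounded_measurableD | apply: bounded_measurableM ].

Lemma bounded_measurable_norm f :
  bounded_measurable f -> bounded_measurable (fun x => `|f x|).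
Proof.
move=> [mf [M fM]]; split; first exact: measurableT_comp.
by exists M => x; rewrite normr_id.
Qed.

Lemma bounded_measurable_btw (f : T -> R) M : measurable_fun setT f ->
  (forall x, 0 <= f x <= M) -> bounded_measurable f.
Proof.
move=> mf fM; split=> //; exists M => x; have /andP[f0 ?] := fM x.
by rewrite ger0_norm.
Qed.

Lemma bounded_measurable_integrable f :
  bounded_measurable f -> mu.-integrable E (EFin \o f).
Proof.
move=> [mf [M fM]]; apply: measurable_bounded_integrable => //.
  exact: measurable_funTS.
exists M; split; first exact: num_real.
by move=> r Mr x _ /=; rewrite (le_trans (fM x))// ltW.
Qed.

Local Notation I g := (\int[mu]_(x in E) g x).

Lemma bounded_integralE f :
  bounded_measurable f -> (\int[mu]_(x in E) (f x)%:E = (I f)%:E)%E.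
Proof.
move=> bf; rewrite fineK//.
exact: (integrable_fin_num mE (bounded_measurable_integrable bf)).
Qed.

Lemma bounded_RintegralD f g :
  bounded_measurable f -> bounded_measurable g ->
  I (fun x => f x + g x) = I f + I g.
Proof.
by move=> bf bg; apply: RintegralD => //; exact: bounded_measurable_integrable.
Qed.

Lemma bounded_RintegralZ r f :
  bounded_measurable f -> I (fun x => r * f x) = r * I f.
Proof. by move=> bf; apply: RintegralZl => //; exact: bounded_measurable_integrable. Qed.

Lemma bounded_RintegralN f :
  bounded_measurable f -> I (fun x => - f x) = - I f.
Proof.
move=> bf; rewrite -mulN1r -bounded_RintegralZ//.
by under [RHS]eq_Rintegral do rewrite mulN1r.
Qed.

Lemma bounded_le_Rintegral f g :
  bounded_measurable f -> bounded_measurable g ->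
  (forall x, f x <= g x) -> I f <= I g.
Proof.
by move=> bf bg fg; apply: le_Rintegral => //; exact: bounded_measurable_integrable.
Qed.

Lemma bounded_Rintegral_lim_le (u : nat -> T -> R) (f : T -> R) M c :
  (forall n, measurable_fun setT (u n)) -> (forall n x, `|u n x| <= M) ->
  measurable_fun setT f ->
  (forall x, u n x @[n --> \oo] --> f x) ->
  (forall n, I (u n) <= c) -> I f <= c.
Proof.
move=> mu_ uM mf uf uc.
have iM : mu.-integrable E (EFin \o (fun=> M)).
  by apply: bounded_measurable_integrable; exact: bounded_measurable_cst.
have bM x : `|f x| <= M.
  apply: (@cvg_seq_le R (fun n => `|u n x|)) => //.
  by apply: cvg_norm; exact: uf.
have bf : bounded_measurable f by split => //; exists M.
have ucvg : I (u n) @[n --> \oo] --> I f.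
  apply: fine_cvg; rewrite fineK; last first.
    exact: (integrable_fin_num mE (bounded_measurable_integrable bf)).
  apply: (@dominated_cvg _ _ _ _ _ mE _ _ (EFin \o (fun=> M))) => //.
- by move=> n; apply/measurable_EFinP; exact: measurable_funTS.
- by move=> x _; apply/fine_cvgP; split; [exact: nearW|exact: uf].
- by move=> n x _; rewrite /= lee_fin.
exact: (cvg_seq_le ucvg).
Qed.

(** * Projection onto a convex solid set *)

Section projection.
Variables (f : T -> R) (K : R) (B : set (T -> R)).
Hypotheses (mf : measurable_fun setT f) (fK : forall x, 0 <= f x <= K).
Hypothesis Bmeas : forall g, B g -> measurable_fun setT g.
Hypothesis B_ge0 : forall g, B g -> forall x, 0 <= g x.
Hypothesis B0 : B (fun=> 0).
Hypothesis Bconvex : forall (g h : T -> R) (t : R), B g -> B h -> 0 <= t <= 1 ->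
  B (fun x => (1 - t) * g x + t * h x).
Hypothesis Bsolid : forall (g h : T -> R), B g -> measurable_fun setT h ->
  (forall x, 0 <= h x <= g x) -> B h.
Hypothesis Bclosed : forall (u : nat -> T -> R) (g : T -> R), (forall n, B (u n)) ->
  measurable_fun setT g ->
  (forall x, nondecreasing_seq (u ^~ x)) -> (forall x, u n x @[n --> \oo] --> g x) ->
  B g.

Let J g := I (fun x => (f x - g x) ^+ 2).
Let B' := [set g | B g /\ forall x, g x <= f x].

Let bf : bounded_measurable f.
Proof. exact: bounded_measurable_btw fK. Qed.

Let bB' g : B' g -> bounded_measurable g.
Proof.
move=> [Bg gf]; apply: (@bounded_measurable_btw _ K); first exact: Bmeas.
by move=> x; rewrite B_ge0//= (le_trans (gf x))//; have /andP[] := fK x.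
Qed.

Let bJ g : bounded_measurable g -> bounded_measurable (fun x => (f x - g x) ^+ 2).
Proof.
move=> bg; have bfg := bounded_measurableD bf (bounded_measurableN bg).
exact: (bounded_measurableM bfg bfg).
Qed.

Let J_ge0 g : 0 <= J g.
Proof. by apply: Rintegral_ge0 => // x _; exact: sqr_ge0. Qed.

Let B'convex (g h : T -> R) (t : R) : B' g -> B' h -> 0 <= t <= 1 ->
  B' (fun x => (1 - t) * g x + t * h x).
Proof.
move=> [Bg gf] [Bh hf] t01; split; first exact: Bconvex.
move=> x; have /andP[t0 t1] := t01; have := gf x; have := hf x; nra.
Qed.

(** The parallelogram identity. As the midpoint of two competitors is a
    competitor, it forces two near-minimisers to be close in [L^2]. *)
Let J_mid (g h : T -> R) : bounded_measurable g -> bounded_measurable h ->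
  I (fun x => (g x - h x) ^+ 2) =
    2 * J g + 2 * J h - 4 * J (fun x => (1 - 2^-1) * g x + 2^-1 * h x).
Proof.
move=> bg bh.
have bm : bounded_measurable (fun x => (1 - 2^-1) * g x + 2^-1 * h x).
  by apply: bounded_measurableD; apply: bounded_measurableM => //;
    exact: bounded_measurable_cst.
rewrite /J -!bounded_RintegralZ; try by bounded_measurability.
rewrite -bounded_RintegralN; last by bounded_measurability.
rewrite -!bounded_RintegralD; try by bounded_measurability.
by apply: eq_Rintegral => x _; field.
Qed.

Let d := inf (J @` B').

Let has_infJ : has_inf (J @` B').
Proof.
split; last by exists 0 => _ [g _ <-]; exact: J_ge0.
exists (J (fun=> 0)); exists (fun=> 0) => //; split => // x.
by have /andP[] := fK x.
Qed.

Let d_le g : B' g -> d <= J g.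
Proof. by move=> Bg; apply: ge_inf; [exact: has_infJ.2|exists g]. Qed.

Let seq_exists : exists g : nat -> T -> R,
  forall k, B' (g k) /\ J (g k) <= d + 4^-1 ^+ k.
Proof.
suff /choice[g gP] : forall k, exists g, B' g /\ J g <= d + 4^-1 ^+ k by exists g.
move=> k; have e0 : 0 < 4^-1 ^+ k :> R by rewrite exprn_gt0// invr_gt0.
by have [_ [g Bg <-] /ltW] := inf_adherent e0 has_infJ; exists g.
Qed.

Section minimizing.
Variables (g : nat -> T -> R).
Hypotheses (gB : forall k, B' (g k)) (gJ : forall k, J (g k) <= d + 4^-1 ^+ k).

Let c := (4 + fine (mu E)).

(** Convergence in [L^1] rather than [L^2] is what the lower envelopes need,
    because the increments are going to be summed. *)
Let L1_cauchy k : I (fun x => `|g k x - g k.+1 x|) <= c * 2^-1 ^+ k.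
Proof.
have bk := bB' (gB k); have bk1 := bB' (gB k.+1).
have bd := bounded_measurableD bk (bounded_measurableN bk1).
have b2 := bounded_measurableM bd bd.
have h : I (fun x => (g k x - g k.+1 x) ^+ 2) <= 4 * 4^-1 ^+ k.
  rewrite J_mid//.
  have : d <= J (fun x => (1 - 2^-1) * g k x + 2^-1 * g k.+1 x).
    by apply: d_le; apply: B'convex => //; apply/andP; split; lra.
  have := gJ k; have := gJ k.+1; rewrite exprS.
  have : 0 < 4^-1 ^+ k :> R by rewrite exprn_gt0// invr_gt0.
  lra.
have p0 : 0 < 2^-1 ^+ k :> R by rewrite exprn_gt0// invr_gt0.
(* |y| <= e^-1 y^2 + e, with e chosen to balance the two terms. *)
pose e : R := 2^-1 ^+ k.
have b3 : bounded_measurable (fun x => e^-1 * (g k x - g k.+1 x) ^+ 2).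
  exact: bounded_measurableM (bounded_measurable_cst _) b2.
apply: (@le_trans _ _ (I (fun x => e^-1 * (g k x - g k.+1 x) ^+ 2 + e))).
  apply: bounded_le_Rintegral; first exact: bounded_measurable_norm.
    by apply: bounded_measurableD => //; exact: bounded_measurable_cst.
  move=> x; set y := (g k x - g k.+1 x).
  rewrite -(real_normK (num_real y)).
  have : 0 <= e^-1 * (`|y| - e) ^+ 2 by rewrite mulr_ge0 ?sqr_ge0// invr_ge0 ltW.
  have -> : e^-1 * (`|y| - e) ^+ 2 = e^-1 * `|y| ^+ 2 + e - 2 * `|y|.
    by field; rewrite gt_eqF.
  have := normr_ge0 y; lra.
rewrite bounded_RintegralD//; last exact: bounded_measurable_cst.
rewrite bounded_RintegralZ// Rintegral_cst// /c mulrDl lerD//; last by rewrite mulrC.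
rewrite mulrC ler_pdivrMr// (le_trans h)// -mulrA -expr2 -exprM mulnC exprM.
by rewrite expr2 -invfM -natrM.
Qed.

Let minrec n := fix minrec l x :=
  if l is l'.+1 then Num.min (minrec l' x) (g (n + l)%N x) else g n x.

Let minrecS n l x : minrec n l.+1 x = Num.min (minrec n l x) (g (n + l.+1)%N x).
Proof. by []. Qed.

Let minrec_le n l x : minrec n l x <= g (n + l)%N x.
Proof. by case: l => [|l]; rewrite ?addn0// minrecS ge_min lexx orbT. Qed.

Let minrec_btw n l x : 0 <= minrec n l x <= g n x.
Proof.
have g0 k y : 0 <= g k y by apply: B_ge0; case: (gB k).
elim: l => [|l /andP[h1 h2]] ; first by rewrite /= lexx g0.
by rewrite minrecS le_min h1 g0 /= ge_min h2.
Qed.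

Let minrec_noninc n x : nonincreasing_seq ((minrec n) ^~ x).
Proof. by apply/nonincreasing_seqP => l; rewrite minrecS ge_min lexx. Qed.

Let minrec_shift n l x : minrec n l.+1 x <= minrec n.+1 l x.
Proof.
elim: l => [|l IH]; first by rewrite /= addn1 ge_min lexx orbT.
by rewrite minrecS [leRHS]minrecS addSnnS le_min2// lexx.
Qed.

Let minrec_bm n l : bounded_measurable (minrec n l).
Proof.
apply: (@bounded_measurable_btw _ K).
  elim: l => [|l IH]; first by apply: Bmeas; case: (gB n).
  by apply: measurable_minr => //; apply: Bmeas; case: (gB (n + l.+1)%N).
move=> x; have /andP[-> h] := minrec_btw n l x; rewrite (le_trans h)//.
by case: (gB n) => _ h'; rewrite (le_trans (h' x))//; have /andP[] := fK x.
Qed.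

(** Lowering the minimum to one more function costs at most the increment to
    that function, and the increments form a geometric series. *)
Let minrec_close n l :
  I (fun x => g n x - minrec n l x) <= 2 * c * (2^-1 ^+ n - 2^-1 ^+ (n + l)).
Proof.
elim: l => [|l IH].
  by under eq_Rintegral do rewrite /= subrr; rewrite /Rintegral integral0 addn0 subrr mulr0.
have bn : bounded_measurable (fun x => g n x - minrec n l x).
  exact: bounded_measurableD (bB' (gB n)) (bounded_measurableN (minrec_bm n l)).
have ba : bounded_measurable (fun x => `|g (n + l)%N x - g (n + l).+1 x|).
  apply: bounded_measurable_norm.
  exact: bounded_measurableD (bB' (gB _)) (bounded_measurableN (bB' (gB _))).
apply: (@le_trans _ _ (I (fun x => (g n x - minrec n l x) +
    `|g (n + l)%N x - g (n + l).+1 x|))).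
  apply: bounded_le_Rintegral.
  - exact: bounded_measurableD (bB' (gB n)) (bounded_measurableN (minrec_bm n l.+1)).
  - exact: bounded_measurableD.
  move=> x; rewrite minrecS addnS.
  have := minrec_le n l x; have := ler_norm (g (n + l)%N x - g (n + l).+1 x).
  have := normr_ge0 (g (n + l)%N x - g (n + l).+1 x).
  by rewrite /Num.min; case: ifPn => _; lra.
rewrite bounded_RintegralD// addnS.
have := L1_cauchy (n + l); rewrite exprS; lra.
Qed.

Let Minf n x := limn ((minrec n) ^~ x).

Let minrec_cvg n x : minrec n l x @[l --> \oo] --> Minf n x.
Proof.
apply: nonincreasing_is_cvgn; first exact: minrec_noninc.
by exists 0 => _ [l _ <-]; case/andP: (minrec_btw n l x).
Qed.

Let Minf_le n l x : Minf n x <= minrec n l x.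
Proof.
apply: (nonincreasing_cvgn_ge (@minrec_noninc n x)).
by apply/cvg_ex; eexists; exact: minrec_cvg.
Qed.

Let Minf_ge0 n x : 0 <= Minf n x.
Proof.
apply: limr_ge; first by apply/cvg_ex; eexists; exact: minrec_cvg.
by apply: nearW => l; case/andP: (minrec_btw n l x).
Qed.

Let Minf_meas n : measurable_fun setT (Minf n).
Proof.
apply: (@measurable_fun_cvg _ _ _ _ (minrec n)).
  by move=> l; case: (minrec_bm n l).
by move=> x _; exact: minrec_cvg.
Qed.

Let Minf_B' n : B' (Minf n).
Proof.
have [Bn nf] := gB n; split; last first.
  by move=> x; apply: (le_trans _ (nf x)); exact: (Minf_le n 0).
apply: (Bsolid Bn) => // x; rewrite Minf_ge0/=; exact: (Minf_le n 0).
Qed.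

Let Minf_nd x : nondecreasing_seq (Minf ^~ x).
Proof.
apply/nondecreasing_seqP => n; apply: limr_ge.
  by apply/cvg_ex; eexists; exact: minrec_cvg.
by apply: nearW => l; apply: (le_trans (Minf_le n l.+1 x)); exact: minrec_shift.
Qed.

Let K0 : 0 <= K.
Proof. by have /andP[] := fK point; exact: le_trans. Qed.

Let c0 : 0 <= c.
Proof. by rewrite addr_ge0// fine_ge0. Qed.

(** On functions with values between 0 and [K] the squared distance to [f] is
    [2K]-Lipschitz, so a small change in [L^1] changes [J] little. *)
Let J_minrec n l : J (minrec n l) <= d + (1 + 4 * K * c) * 2^-1 ^+ n.
Proof.
have bg := bB' (gB n).
have bd : bounded_measurable (fun x => g n x - minrec n l x).
  exact: bounded_measurableD bg (bounded_measurableN (minrec_bm n l)).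
have bKd : bounded_measurable (fun x => 2 * K * (g n x - minrec n l x)).
  exact: bounded_measurableM (bounded_measurable_cst _) bd.
have h1 : J (minrec n l) <= J (g n) + 2 * K * I (fun x => g n x - minrec n l x).
  rewrite -bounded_RintegralZ// -bounded_RintegralD//; last exact: bJ.
  apply: bounded_le_Rintegral; first exact: bJ.
    by apply: bounded_measurableD => //; exact: bJ.
  move=> x; have /andP[m0 mg] := minrec_btw n l x.
  have [_ /(_ x) gf] := gB n; have /andP[_ fKx] := fK x.
  nra.
have p0 k : 0 <= 2^-1 ^+ k :> R by rewrite exprn_ge0// invr_ge0.
have h2 : I (fun x => g n x - minrec n l x) <= 2 * c * 2^-1 ^+ n.
  apply: (le_trans (minrec_close n l)); rewrite ler_wpM2l ?mulr_ge0//.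
  by rewrite gerBl.
have h3 : 4^-1 ^+ n <= 2^-1 ^+ n :> R.
  by rewrite lerXn2r// ?nnegrE ?invr_ge0// lef_pV2 ?posrE// ler_nat.
have := gJ n; have : 2 * K * I (fun x => g n x - minrec n l x) <=
    2 * K * (2 * c * 2^-1 ^+ n) by rewrite ler_wpM2l// mulr_ge0.
lra.
Qed.

Let J_Minf n : J (Minf n) <= d + (1 + 4 * K * c) * 2^-1 ^+ n.
Proof.
apply: (@bounded_Rintegral_lim_le (fun l x => (f x - minrec n l x) ^+ 2) _ (K ^+ 2)).
- by move=> l; case: (bJ (minrec_bm n l)).
- move=> l x; rewrite ger0_norm ?sqr_ge0//.
  have /andP[m0 mg] := minrec_btw n l x.
  have [_ /(_ x) gf] := gB n; have /andP[_ fKx] := fK x.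
  nra.
- by case: (bJ (bB' (Minf_B' n))).
- move=> x; apply: (@cvgM R).
    by apply: cvgB; [exact: cvg_cst|exact: minrec_cvg].
  by apply: cvgB; [exact: cvg_cst|exact: minrec_cvg].
- by move=> l; exact: J_minrec.
Qed.

Let g0 x := limn (Minf ^~ x).

Let Minf_cvg x : Minf n x @[n --> \oo] --> g0 x.
Proof.
apply: nondecreasing_is_cvgn; first exact: Minf_nd.
by exists (f x) => _ [n _ <-]; case: (Minf_B' n).
Qed.

Let g0_B' : B' g0.
Proof.
split; last first.
  by move=> x; apply: (cvg_seq_le (Minf_cvg (x := x))) => n; case: (Minf_B' n).
apply: (@Bclosed Minf) => //; first by move=> n; case: (Minf_B' n).
apply: (@measurable_fun_cvg _ _ _ _ Minf); first exact: Minf_meas.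
by move=> x _; exact: Minf_cvg.
Qed.

(** The envelopes increase to [g0] below [f], hence [g0] is closer to [f] than
    each of them. *)
Let J_g0 : J g0 <= d.
Proof.
have Jn n : J g0 <= d + (1 + 4 * K * c) * 2^-1 ^+ n.
  apply: le_trans (J_Minf n).
  apply: bounded_le_Rintegral; [exact/bJ/bB'|exact/bJ/bB'/Minf_B'|].
  move=> x; have [_ /(_ x) gf] := g0_B'.
  have : Minf n x <= g0 x.
    apply: (nondecreasing_cvgn_le (Minf_nd x)).
    by apply/cvg_ex; eexists; exact: Minf_cvg.
  have := Minf_ge0 n x; nra.
have z1 : `|2^-1 : R| < 1 by rewrite ger0_norm ?invr_ge0// invf_lt1 ?ltr1n.
have := cvg_geometric (1 + 4 * K * c) z1 => gc.
rewrite -[leLHS]subr0.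
apply: (@cvg_seq_le R (fun n => J g0 - geometric (1 + 4 * K * c) 2^-1 n)).
  by apply: cvgB => //; exact: cvg_cst.
by move=> n; rewrite lerBlDr; exact: Jn.
Qed.

Lemma minimizing_limit : exists g0, B' g0 /\ J g0 <= d.
Proof. by exists g0. Qed.

End minimizing.

(** The variational inequality of the projection [g0] of [f] onto [B]: [J] does
    not decrease when [g0] is moved towards another point of [B]. Solidity of
    [B] is used to bring competitors below [f], where they are bounded. *)
Lemma variational_inequality : exists g0, [/\ B g0, forall x, g0 x <= f x &
  forall g, B g -> bounded_measurable g ->
    I (fun x => g x * (f x - g0 x)) <= I (fun x => g0 x * (f x - g0 x))].
Proof.
have [g_ gP] := seq_exists.
have [g0 [[Bg0 g0f] Jg0]] :=
  minimizing_limit (fun k => (gP k).1) (fun k => (gP k).2).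
exists g0; split => // g Bg bg.
have b0 : bounded_measurable g0 by exact: bB'.
have bd := bounded_measurableD bg (bounded_measurableN b0).
have bfi := bounded_measurableD bf (bounded_measurableN b0).
have bdd := bounded_measurableM bd bd.
have bdf := bounded_measurableM bd bfi.
pose A := I (fun x => (g x - g0 x) * (f x - g0 x)).
pose Q := I (fun x => (g x - g0 x) * (g x - g0 x)).
have Q0 : 0 <= Q by apply: Rintegral_ge0 => // x _; rewrite -expr2 sqr_ge0.
have key t : 0 < t <= 1 -> 2 * A <= t * Q.
  move=> /andP[t0 t1].
  (* k need not lie below f, but cutting it at f brings it closer to f. *)
  pose k x := (1 - t) * g0 x + t * g x.
  have bk : bounded_measurable k.
    by apply: bounded_measurableD; apply: bounded_measurableM => //;
      exact: bounded_measurable_cst.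
  have Bk : B k by apply: Bconvex => //; rewrite (ltW t0).
  have mk : measurable_fun setT (fun x => Num.min (k x) (f x)).
    by apply: measurable_minr => //; case: bk.
  have B'k : B' (fun x => Num.min (k x) (f x)).
    split; last by move=> x; rewrite ge_min lexx orbT.
    apply: (Bsolid Bk) => // x; rewrite le_min ge_min lexx andbT B_ge0//=.
    by have /andP[] := fK x.
  have Jk : J (fun x => Num.min (k x) (f x)) <= J k.
    apply: bounded_le_Rintegral; [exact/bJ/bB'|exact: bJ|].
    move=> x; rewrite /Num.min; case: ifPn => // _.
    by rewrite subrr expr0n/= sqr_ge0.
  have JE : J k = J g0 + (- (2 * t)) * A + t ^+ 2 * Q.
    rewrite /J /A /Q -!bounded_RintegralZ; try by bounded_measurability.
    rewrite -!bounded_RintegralD; try by bounded_measurability.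
    by apply: eq_Rintegral => x _; rewrite /k; ring.
  have := d_le B'k => dJ.
  have : 0 <= t * (t * Q - 2 * A) by lra.
  by rewrite pmulr_rge0// subr_ge0.
have A0 : A <= 0.
  rewrite leNgt; apply/negP => Apos.
  have Q1 : 0 < Q + A + 1 by lra.
  (* The first-order term wins for small t; this t is small enough, and adding
     A + 1 to Q keeps it in the unit interval. *)
  have t01 : 0 < A / (Q + A + 1) <= 1.
    by rewrite divr_gt0//= ler_pdivrMr// mul1r; lra.
  have := key _ t01; rewrite mulrAC ler_pdivlMr//; nra.
have AE : A = I (fun x => g x * (f x - g0 x)) + - I (fun x => g0 x * (f x - g0 x)).
  rewrite -bounded_RintegralN; last exact: bounded_measurableM.
  rewrite -bounded_RintegralD.
  - by apply: eq_Rintegral => x _; ring.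
  - exact: bounded_measurableM.
  - by apply: bounded_measurableN; exact: bounded_measurableM.
by move: A0; rewrite AE subr_le0.
Qed.

End projection.
End bounded_integral.

(** * Cores of a weight *)

Section weight_core.
Context {R : realType} {n : nat}.
Local Notation mu := (lebesgue R n).
Implicit Types w f g : Rn R n -> \bar R.

(** The cores exhaust the space up to a null set. On each of them the weighted
    and the Lebesgue measure are finite and comparable. *)
Definition core w (k : nat) : set (Rn R n) :=
  cube [tuple (- k.+1%:R : R) | i < n] (2 * k.+1%:R) `&`
  [set x | (k.+1%:R^-1%:E <= w x)%E /\ (w x <= k.+1%:R%:E)%E].

Lemma measurable_core w k : measurable_fun setT w -> measurable (core w k).
Proof.
move=> mw; apply: measurableI; first exact: measurable_cube.
rewrite (_ : [set x | _] = (setT `&` [set x | (k.+1%:R^-1%:E <= w x)%E]) `&`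
    (setT `&` [set x | (w x <= k.+1%:R%:E)%E])); last first.
  by rewrite !setTI.
by apply: measurableI; [exact: emeasurable_fun_c_infty|exact: emeasurable_fun_infty_c].
Qed.

Lemma core_lebesgue w k : measurable_fun setT w -> (mu (core w k) < +oo)%E.
Proof.
move=> mw.
apply: (@le_lt_trans _ _ (mu (cube [tuple (- k.+1%:R : R) | i < n] (2 * k.+1%:R)))).
  apply: le_measure; rewrite ?inE; [exact: measurable_core|exact: measurable_cube|].
  by move=> x [].
by rewrite lebesgue_cube ?mulr_gt0// ltry.
Qed.

Lemma core_fin_num w k x : core w k x -> w x \is a fin_num.
Proof.
move=> [_ [h1 h2]]; rewrite fin_numElt (lt_le_trans _ h1) ?ltNyr//=.
by rewrite (le_lt_trans h2)// ltry.
Qed.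

Lemma core_gt0 w k x : core w k x -> (0 < w x)%E.
Proof. by move=> [_ [h1 h2]]; rewrite (lt_le_trans _ h1)// lte_fin invr_gt0. Qed.

Lemma core_nondecreasing w : {homo core w : i j / (i <= j)%N >-> i `<=` j}.
Proof.
move=> i j ij x [cx [h1 h2]]; have ijR : i.+1%:R <= j.+1%:R :> R by rewrite ler_nat.
split; first by move=> l; have := cx l; rewrite !tnth_mktuple; lra.
split; last by rewrite (le_trans h2)// lee_fin.
by rewrite (le_trans _ h1)// lee_fin lef_pV2 ?posrE.
Qed.

Lemma core_wmeasure w k : measurable_fun setT w -> (wmeasure w (core w k) < +oo)%E.
Proof.
move=> mw; apply: (@le_lt_trans _ _ (\int[mu]_(x in core w k) k.+1%:R%:E)%E).
  apply: ge0_le_integral => //; first exact: measurable_core.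
  - by move=> x /core_gt0/ltW.
  - exact: measurable_funTS.
  - by move=> x [_ []].
rewrite integral_cst; last exact: measurable_core.
by rewrite lte_mul_pinfty ?lee_fin// core_lebesgue.
Qed.

Lemma ae_core w : weight w -> {ae mu, forall x, exists k, core w k x}.
Proof.
move=> [mw]; apply: filterS => x /andP[w0 wy].
have wf : w x \is a fin_num by rewrite ge0_fin_numE// ltW.
have [i ci] := cube_covers x.
pose r := fine (w x); have rE : w x = r%:E by rewrite fineK.
have r0 : 0 < r by rewrite -lte_fin -rE.
pose k := maxn i (maxn (Num.bound r) (Num.bound r^-1)); exists k; split; last split.
- have ik : i.+1%:R <= k.+1%:R :> R by rewrite ler_nat ltnS leq_maxl.
  by move=> l; have := ci l; rewrite !tnth_mktuple; lra.
- rewrite rE lee_fin invf_ple ?posrE//.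
  apply: (le_trans (ltW (archi_boundP _))); first by rewrite invr_ge0 ltW.
  by rewrite ler_nat leqW// !leq_max leqnn !orbT.
- rewrite rE lee_fin (le_trans (ltW (archi_boundP (ltW r0))))//.
  by rewrite ler_nat leqW// !leq_max leqnn !orbT.
Qed.

(** A weight may take negative values on a null set; its absolute value does
    not, and nonnegative integrands are what monotonicity and the convergence
    theorems require. *)
Lemma integral_weight_abs w f : weight w -> measurable_fun setT f ->
  (\int[mu]_x (f x * w x) = \int[mu]_x (f x * `|w x|))%E.
Proof.
move=> [mw w0] mf; apply: ae_eq_integral; first exact: measurableT.
- exact: emeasurable_funM.
- by apply: emeasurable_funM; [exact: mf|exact: measurableT_comp].
- by apply: filterS w0 => x /andP[w0 _] _; rewrite gee0_abs// ltW.
Qed.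

(** Dividing by [w] turns a pairing against [w dx] into a pairing against [dx],
    so that the projection argument can be run in the unweighted [L^2]. *)
Definition core_density w k (psi : Rn R n -> R) (x : Rn R n) : R :=
  psi x * \1_(core w k) x / fine (w x).

Lemma core_density_ge0 w k psi x : (forall y, 0 <= psi y) ->
  0 <= core_density w k psi x.
Proof.
move=> psi0; rewrite /core_density indicE; case: (boolP (x \in _)) => [|_]; last first.
  by rewrite mulr0 mul0r.
rewrite inE => /core_gt0/ltW w0; rewrite mulr1 divr_ge0//; exact: fine_ge0.
Qed.

Lemma measurable_core_density w k psi : measurable_fun setT w ->
  measurable_fun setT psi -> measurable_fun setT (core_density w k psi).
Proof.
move=> mw mpsi; apply: measurable_funM.
  apply: measurable_funM; first exact: mpsi.
  by apply: measurable_indic; exact: measurable_core.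
by apply: measurable_funV; apply: measurableT_comp; [exact: fine_measurable|exact: mw].
Qed.

Lemma integral_core_density w k psi f : measurable_fun setT w ->
  (forall y, 0 <= psi y) ->
  (\int[mu]_x (`|(core_density w k psi x)%:E * f x| * w x) =
   \int[mu]_(x in core w k) ((psi x)%:E * `|f x|))%E.
Proof.
move=> mw psi0; rewrite [RHS]integral_mkcond; apply: eq_integral => x _.
rewrite /patch /core_density indicE; case: (boolP (x \in _)) => [|_]; last first.
  by rewrite mulr0 mul0r mul0e abse0 mul0e.
rewrite inE => cx; have w0 := core_gt0 cx; have wf := core_fin_num cx.
rewrite mulr1 abseM -{2}(fineK wf).
have v0 : 0 < fine (w x) by rewrite fine_gt0// w0 ltey_eq wf.
rewrite gee0_abs ?lee_fin ?divr_ge0// ?ltW//.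
by rewrite muleAC -EFinM divfK// gt_eqF.
Qed.

End weight_core.

(** * Separation from the unit ball of a Banach function space *)

Lemma cvg_ereal_seq_le {R : realType} (v : nat -> \bar R) (l c : \bar R) :
  v n @[n --> \oo] --> l -> (forall n, (v n <= c)%E) -> (l <= c)%E.
Proof.
move=> vl vc; rewrite -(cvg_lim _ vl)//; apply: lime_le.
  by apply/cvg_ex; exists l.
exact: nearW.
Qed.

Section separation.
Context {R : realType} {n : nat} (w : Rn R n -> \bar R)
  (N : (Rn R n -> \bar R) -> \bar R).
Hypotheses (hw : weight w) (hN : BFS w N).
Local Notation mu := (lebesgue R n).
Implicit Types (f g : Rn R n -> \bar R).

Let mw : measurable_fun setT w := proj1 hw.

(** The projection argument runs on real functions, so the infinite values that
    [N] allows are left out. *)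
Definition unit_ball : set (Rn R n -> R) := [set g : Rn R n -> R | [/\ measurable_fun setT g,
  forall x, 0 <= g x & (N (EFin \o g) <= 1)%E]].

Lemma unit_ball0 : unit_ball (fun=> 0).
Proof.
split => //.
rewrite (_ : N _ = 0%E)//; apply/(BFS_eq0 hN) => /=; first exact: measurable_cst.
exact: aeW.
Qed.

Lemma unit_ball_convex (g h : Rn R n -> R) (t : R) :
  unit_ball g -> unit_ball h -> 0 <= t <= 1 ->
  unit_ball (fun x => (1 - t) * g x + t * h x).
Proof.
move=> [mg g0 Ng] [mh h0 Nh] /andP[t0 t1].
have s0 : 0 <= 1 - t by rewrite subr_ge0.
have mZ (r : R) (k : Rn R n -> R) : measurable_fun setT k -> measurable_fun setT (fun x => r * k x).
  by move=> mk; apply: measurable_funM; [exact: measurable_cst|exact: mk].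
split.
- by apply: measurable_funD; exact: mZ.
- by move=> x; rewrite addr_ge0// mulr_ge0.
rewrite (_ : _ \o _ = fun x => ((1 - t)%:E * (EFin \o g) x + t%:E * (EFin \o h) x)%E); last first.
  by apply/funext => x /=; rewrite EFinD !EFinM.
have mE (k : Rn R n -> R) : measurable_fun setT k -> measurable_fun setT (EFin \o k).
  by move=> mk; apply/measurable_EFinP; exact: mk.
have mEZ (r : R) (k : Rn R n -> R) : measurable_fun setT k ->
    measurable_fun setT (fun x => r%:E * (EFin \o k) x)%E.
  move=> mk; apply: emeasurable_funM; [exact: measurable_cst|exact: mE].
apply: (le_trans (BFS_add hN (mEZ _ _ mg) (mEZ _ _ mh))).
rewrite !(BFS_scale hN _ (mE _ _))// !ger0_norm//.
apply: (@le_trans _ _ ((1 - t)%:E * 1 + t%:E * 1)%E).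
  by apply: leeD; apply: lee_wpmul2l => //; rewrite lee_fin.
by rewrite !mule1 -EFinD subrK.
Qed.

Lemma unit_ball_solid (g h : Rn R n -> R) : unit_ball g -> measurable_fun setT h ->
  (forall x, 0 <= h x <= g x) -> unit_ball h.
Proof.
move=> [mg g0 Ng] mh hg; split; first exact: mh.
  by move=> x; case/andP: (hg x).
apply: le_trans Ng; apply: (BFS_le hN).
- by apply/measurable_EFinP; exact: mh.
- by apply/measurable_EFinP; exact: mg.
apply: aeW => x /=; have /andP[h0 h1] := hg x.
by rewrite lee_fin !ger0_norm.
Qed.

(** This is the Fatou property of the norm. *)
Lemma unit_ball_closed (u : nat -> Rn R n -> R) (g : Rn R n -> R) :
  (forall k, unit_ball (u k)) -> measurable_fun setT g ->
  (forall x, nondecreasing_seq (u ^~ x)) -> (forall x, u k x @[k --> \oo] --> g x) ->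
  unit_ball g.
Proof.
move=> uB mg und ug; have u0 k x : 0 <= u k x by have [_ ->] := uB k.
have g0 x : 0 <= g x.
  apply: le_trans (u0 0%N x) _; rewrite -(cvg_lim _ (ug x))//.
  apply: nondecreasing_cvgn_le => //; by apply/cvg_ex; exists (g x).
split; [exact: mg|exact: g0|].
have [||| _ Ncvg] := @BFS_fatou _ _ _ _ hN (fun k => EFin \o u k) (EFin \o g).
- by move=> k; apply/measurable_EFinP; have [] := uB k.
- by apply/measurable_EFinP; exact: mg.
- apply: aeW => x; split.
    by move=> i j ij /=; rewrite lee_fin !ger0_norm//; exact: und.
  rewrite /= ger0_norm//; apply/fine_cvgP; split; first exact: nearW.
  under eq_fun do rewrite /= ger0_norm//.
  exact: ug.
by apply: (cvg_ereal_seq_le Ncvg) => k; have [] := uB k.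
Qed.

Let trunc f k (x : Rn R n) : R := truncation f k x * \1_(core w k) x.

Let measurable_trunc f k : measurable_fun setT f -> measurable_fun setT (trunc f k).
Proof.
move=> mf; apply: measurable_funM; first exact: measurable_truncation.
by apply: measurable_indic; exact: measurable_core.
Qed.

Let trunc_btw f k x : 0 <= trunc f k x <= k%:R.
Proof.
rewrite /trunc indicE; have := truncation_btw f k x.
by case: (_ \in _); rewrite ?mulr1// mulr0 lexx ler0n.
Qed.

Let trunc_exhausts f : measurable_fun setT f -> (1 < N f)%E ->
  exists k, (1 < N (EFin \o trunc f k))%E.
Proof.
move=> mf Nf; apply: contrapT => /forallNP h.
have [||| _ Ncvg] := @BFS_fatou _ _ _ _ hN (fun k => EFin \o trunc f k) f.
- by move=> k; apply/measurable_EFinP; exact: measurable_trunc.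
- exact: mf.
- apply: filterS (ae_core hw) => x [k0 ck0]; split.
    apply/nondecreasing_seqP => k /=; rewrite lee_fin.
    rewrite !ger0_norm; [|by case/andP: (trunc_btw f k.+1 x)|
      by case/andP: (trunc_btw f k x)].
    rewrite /trunc !indicE; case: (boolP (x \in core w k)) => ck; last first.
      by rewrite mulr0; case/andP: (trunc_btw f k.+1 x); rewrite /trunc indicE.
    rewrite mem_set ?mulr1; first exact: truncation_nondecreasing.
    by apply: (core_nondecreasing (leqnSn k)); rewrite inE in ck.
  apply: cvg_trans (truncation_cvg (f := f) (x := x)); apply: near_eq_cvg.
  near=> k; rewrite /= ger0_norm; last by case/andP: (trunc_btw f k x).
  rewrite /trunc indicE mem_set ?mulr1//.
  apply: (core_nondecreasing _ ck0); near: k; exact: nbhs_infty_ge.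
move: Nf; rewrite ltNge => /negP; apply.
by apply: (cvg_ereal_seq_le Ncvg) => k; rewrite leNgt; apply/negP/h.
Unshelve. all: by end_near. Qed.


(** Half of the Lorentz-Luxemburg theorem. The separating functional is
    [f_k - g0], where [f_k] is a truncation of [f] and [g0] its projection onto
    the unit ball, normalised to take the value 1 at [f_k]. *)
Lemma separation f : measurable_fun setT f -> (1 < N f)%E ->
  exists phi : Rn R n -> R, [/\ measurable_fun setT phi, forall x, 0 <= phi x,
    (associate w N (EFin \o phi) <= 1)%E &
    (1 <= \int[mu]_x (`|(phi x)%:E * f x| * w x))%E].
Proof.
move=> mf Nf; have [k Nk] := trunc_exhausts mf Nf.
pose E := core w k; pose fk := trunc f k.
have mE : measurable E by exact: measurable_core.
have muE : (mu E < +oo)%E by exact: core_lebesgue.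
have mfk : measurable_fun setT fk by exact: measurable_trunc.
have [g0 [Bg0 g0f vi]] := variational_inequality mE muE mfk (trunc_btw f k)
  (fun h (Bh : unit_ball h) => let: And3 mh _ _ := Bh in mh)
  (fun h (Bh : unit_ball h) => let: And3 _ h0 _ := Bh in h0)
  unit_ball0 unit_ball_convex unit_ball_solid unit_ball_closed.
have [mg0 g00 Ng0] := Bg0.
pose psi x := fk x - g0 x.
have psi0 x : 0 <= psi x by rewrite subr_ge0; exact: g0f.
have bfk : bounded_measurable fk.
  by apply: (@bounded_measurable_btw _ _ _ _ k%:R); [exact: mfk|exact: trunc_btw].
have bg0 : bounded_measurable g0.
  apply: (@bounded_measurable_btw _ _ _ _ k%:R); first exact: mg0.
  by move=> x; rewrite g00/= (le_trans (g0f x))//; case/andP: (trunc_btw f k x).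
have bpsi : bounded_measurable psi.
  exact: bounded_measurableD bfk (bounded_measurableN bg0).
have mpsi : measurable_fun setT psi by case: bpsi.
pose lam := (\int[mu]_(x in E) (fk x * psi x))%R.
have lamE : (\int[mu]_(x in E) (fk x * psi x)%:E = lam%:E)%E.
  by apply: bounded_integralE; [exact: mE|exact: muE|exact: bounded_measurableM].
have fk0 x : 0 <= fk x by case/andP: (trunc_btw f k x).
have lam_ge0 : 0 <= lam.
  by apply: Rintegral_ge0 => // x _; rewrite mulr_ge0.
(* Otherwise f_k = 0 or f_k = g0 at almost every point, and the norm of f_k is
   at most that of g0. *)
have lam0 : 0 < lam.
  rewrite lt_neqAle lam_ge0 andbT; apply/eqP => lamz.
  move: Nk; rewrite ltNge => /negP; apply; apply: le_trans Ng0.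
  have /ae_eq_integral_abs : (\int[mu]_(x in E) `|(fk x * psi x)%:E| = 0)%E.
    rewrite -[RHS]/(0%:E) lamz -lamE; apply: eq_integral => x _.
    by rewrite gee0_abs// lee_fin mulr_ge0.
  move=> /(_ mE) h.
  apply: (BFS_le hN).
  - by apply/measurable_EFinP; exact: mfk.
  - by apply/measurable_EFinP; exact: mg0.
  have mfp : measurable_fun E (fun x => (fk x * psi x)%:E).
    apply/measurable_EFinP; apply: measurable_funTS.
    by have [] := bounded_measurableM bfk bpsi.
  apply: filterS (h mfp) => x hx.
  suff : fk x <= g0 x by rewrite /= !ger0_norm// lee_fin.
  have [xE|xE] := pselect (E x); last by rewrite /fk /trunc indicE memNset// mulr0.
  have [/eqP] := hx xE; rewrite mulf_eq0 => /orP[/eqP -> //|].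
  by rewrite subr_eq0 => /eqP ->.
exists (core_density w k (fun x => lam^-1 * psi x)).
have lpsi0 x : 0 <= lam^-1 * psi x by rewrite mulr_ge0// invr_ge0.
have split_lam g : measurable_fun setT g ->
    (\int[mu]_(x in E) ((lam^-1 * psi x)%:E * `|g x|) =
     lam^-1%:E * \int[mu]_(x in E) ((psi x)%:E * `|g x|))%E.
  move=> mg; rewrite -ge0_integralZl//.
  - by apply: eq_integral => x _; rewrite EFinM muleA.
  - apply: measurable_funTS; apply: emeasurable_funM.
      by apply/measurable_EFinP; exact: mpsi.
    by apply: measurableT_comp; [exact: abse_measurable|exact: mg].
  - by move=> x _; rewrite mule_ge0// lee_fin.
  - by rewrite lee_fin invr_ge0.
split.
- apply: measurable_core_density; first exact: mw.
  by apply: measurable_funM; [exact: measurable_cst|exact: mpsi].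
- by move=> x; exact: core_density_ge0.
- apply: ge_ereal_sup => _ [g [mg Ng] <-].
  rewrite integral_core_density// split_lam//.
  rewrite lee_pdivrMl// mule1.
  (* The variational inequality concerns bounded functions; g is reached by
     monotone convergence. *)
  have mt j : measurable_fun setT (truncation g j) by exact: measurable_truncation.
  have bt j : bounded_measurable (truncation g j).
    exact: bounded_measurable_btw (mt j) (truncation_btw g j).
  have Bt j : unit_ball (truncation g j).
    split; [exact: mt|by move=> x; case/andP: (truncation_btw g j x)|].
    apply: le_trans Ng; apply: (BFS_le hN); [|exact: mg|].
      by apply/measurable_EFinP; exact: mt.
    apply: aeW => x /=; rewrite ger0_norm; first exact: truncation_le.
    by case/andP: (truncation_btw g j x).
  have tcvg x : (truncation g j x * psi x)%:E @[j --> \oo] --> ((psi x)%:E * `|g x|)%E.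
    under eq_fun do rewrite mulrC EFinM.
    by apply: cvgeZl => //; exact: truncation_cvg.
  have icvg : (\int[mu]_(x in E) (truncation g j x * psi x)%:E)%E @[j --> \oo] -->
      (\int[mu]_(x in E) ((psi x)%:E * `|g x|))%E.
    rewrite (_ : (\int[mu]_(x in E) ((psi x)%:E * `|g x|))%E =
        (\int[mu]_(x in E) (limn (fun j => (truncation g j x * psi x)%:E)))%E); last first.
      by apply: eq_integral => x _; apply/esym/cvg_lim => //; exact: tcvg.
    apply: cvg_monotone_convergence.
    - exact: mE.
    - move=> j; apply/measurable_EFinP; apply: measurable_funTS.
      by have [] := bounded_measurableM (bt j) bpsi.
    - move=> j x _; rewrite lee_fin mulr_ge0//.
      by case/andP: (truncation_btw g j x).
    - by move=> x _ i j ij; rewrite lee_fin ler_wpM2r//; exact: truncation_nondecreasing.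
  apply: (cvg_ereal_seq_le icvg) => j.
  rewrite (bounded_integralE mE muE (bounded_measurableM (bt j) bpsi)) lee_fin.
  apply: (le_trans (vi _ (Bt j) (bt j))).
  apply: bounded_le_Rintegral.
  - exact: mE.
  - exact: muE.
  - exact: bounded_measurableM bg0 bpsi.
  - exact: bounded_measurableM bfk bpsi.
  - by move=> x; apply: ler_wpM2r; [exact: psi0|exact: g0f].
- rewrite integral_core_density// split_lam// lee_pdivlMl// mule1 -lamE.
  apply: ge0_le_integral.
  + exact: mE.
  + by move=> x _; rewrite lee_fin mulr_ge0.
  + apply/measurable_EFinP; apply: measurable_funTS.
    by have [] := bounded_measurableM bfk bpsi.
  + apply: measurable_funTS; apply: emeasurable_funM.
      by apply/measurable_EFinP; exact: mpsi.
    by apply: measurableT_comp; [exact: abse_measurable|exact: mf].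
  + move=> x xE; rewrite mulrC EFinM lee_wpmul2l ?lee_fin//.
    by rewrite /fk /trunc indicE mem_set// mulr1 truncation_le.
Qed.

End separation.

Local Open Scope ereal_scope.

(** * The associate norm and duality *)

(** The factor [c] may be infinite, in which case both sides are infinite as
    soon as one term of the series is positive. *)
Lemma nneseries_geMl {R : realType} (c : \bar R) (u : nat -> R) :
  0 <= c -> (forall k, (0 <= u k)%R) ->
  c * \sum_(0 <= k <oo) (u k)%:E <= \sum_(0 <= k <oo) (c * (u k)%:E).
Proof.
move=> c0 u0; have [[r cE]|cE|cE] : [\/ exists r : R, c = r%:E, c = +oo | c = -oo].
- by case: c {c0} => [r| |]; [constructor 1; exists r|constructor 2|constructor 3].
- by rewrite cE nneseriesZl// => k _; rewrite lee_fin.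
- have [uz|/existsNP[k /eqP uk]] := pselect (forall k, u k = 0%R).
    by rewrite eseries0 => [|k _ _]; rewrite ?uz// mule0 nneseries_ge0// => k _ _;
      rewrite uz mule0.
  have {}uk : (0 < u k)%R by rewrite lt_neqAle eq_sym uk u0.
  rewrite [leRHS](@eseries_pinfty _ _ xpredT k) ?leey//.
    by move=> j _; rewrite -ltNye (lt_le_trans (ltNyr 0%R))// mule_ge0// ?lee_fin.
  by rewrite cE gt0_mulye// lte_fin.
- by rewrite cE in c0.
Qed.

Section duality.
Context {R : realType} {n : nat} (w : Rn R n -> \bar R)
  (N : (Rn R n -> \bar R) -> \bar R).
Hypotheses (hw : weight w) (hN : BFS w N).
Local Notation mu := (lebesgue R n).
Implicit Types (f g h : Rn R n -> \bar R).

Let mw : measurable_fun setT w := proj1 hw.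

Lemma integral_associate_le h g : measurable_fun setT g -> N g <= 1 ->
  \int[mu]_x (`|h x * g x| * w x) <= associate w N h.
Proof. by move=> mg Ng; apply: ereal_sup_ubound; exists g. Qed.

Lemma measurable_absM h g : measurable_fun setT h -> measurable_fun setT g ->
  measurable_fun setT (fun x => `|h x * g x|).
Proof.
move=> mh mg; apply: measurableT_comp; first exact: abse_measurable.
exact: emeasurable_funM.
Qed.

Lemma integral_pairingE h g : measurable_fun setT h -> measurable_fun setT g ->
  \int[mu]_x (`|h x * g x| * w x) = \int[mu]_x (`|h x| * (`|g x| * `|w x|)).
Proof.
move=> mh mg; rewrite (integral_weight_abs hw (measurable_absM mh mg)).
by apply: eq_integral => x _; rewrite abseM muleA.
Qed.

Let mabs g : measurable_fun setT g -> measurable_fun setT (fun x => `|g x|).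
Proof. by move=> mg; apply: measurableT_comp; [exact: abse_measurable|exact: mg]. Qed.

Let mgw g : measurable_fun setT g -> measurable_fun setT (fun x => `|g x| * `|w x|).
Proof. by move=> mg; apply: emeasurable_funM; exact: mabs. Qed.

Lemma associate_ae_eq h h' : measurable_fun setT h -> measurable_fun setT h' ->
  {ae mu, forall x, h x = h' x} -> associate w N h = associate w N h'.
Proof.
move=> mh mh' hh'; rewrite /associate; congr ereal_sup.
apply: eq_imagel => g [mg _]; apply: ae_eq_integral; first exact: measurableT.
- by apply: emeasurable_funM; [exact: measurable_absM|exact: mw].
- by apply: emeasurable_funM; [exact: measurable_absM|exact: mw].
by apply: filterS hh' => x -> _.
Qed.

Lemma associateD_le h h' : measurable_fun setT h -> measurable_fun setT h' ->
  (forall x, 0 <= h x) -> (forall x, 0 <= h' x) ->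
  associate w N (fun x => h x + h' x) <= associate w N h + associate w N h'.
Proof.
move=> mh mh' h0 h'0; apply: ge_ereal_sup => _ [g [mg Ng] <-].
rewrite (integral_pairingE (emeasurable_funD mh mh') mg).
apply: (@le_trans _ _ (\int[mu]_x (`|h x| * (`|g x| * `|w x|)) +
                       \int[mu]_x (`|h' x| * (`|g x| * `|w x|)))).
  rewrite -ge0_integralD.
  - rewrite le_eqVlt; apply/orP; left; apply/eqP/eq_integral => x _.
    rewrite (gee0_abs (adde_ge0 (h0 x) (h'0 x))) (gee0_abs (h0 x)) (gee0_abs (h'0 x)).
    by rewrite ge0_muleDl.
  - exact: measurableT.
  - by move=> x _; rewrite !mule_ge0.
  - by apply: emeasurable_funM; [exact: mabs|exact: mgw].
  - by move=> x _; rewrite !mule_ge0.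
  - by apply: emeasurable_funM; [exact: mabs|exact: mgw].
by rewrite -!integral_pairingE//; apply: leeD; exact: integral_associate_le.
Qed.

(** The indicator of each core is in the associate space, because functions of
    the space are integrable on sets of finite weighted measure. A series of
    these indicators with small positive coefficients is positive wherever the
    cores reach, that is, almost everywhere. *)
Lemma positive_associate : exists h : Rn R n -> R, [/\ measurable_fun setT h,
  forall x, (0 <= h x)%R, {ae mu, forall x, (0 < h x)%R} &
  associate w N (EFin \o h) <= 1].
Proof.
have /choice[C CP] k := BFS_int hN (measurable_core k mw) (core_wmeasure k mw).
(* The factor q k makes the series converge, the factor 1 / (1 + C k) bounds the
   norm of its terms. *)
pose q k : R := (1 / (2 ^ k.+1)%:R)%R; pose a k : R := (q k / (1 + C k))%R.
have q0 k : (0 < q k)%R by rewrite divr_gt0// ltr0n expn_gt0.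
have C0 k : (0 < C k)%R by have [] := CP k.
have a0 k : (0 < a k)%R by rewrite divr_gt0// addr_gt0.
have aC k : (a k * C k <= q k)%R.
  by rewrite mulrAC ler_pdivrMr ?addr_gt0// ler_wpM2l ?(ltW (q0 k))// lerDr.
have a_le k : (a k <= q k)%R.
  by rewrite ler_pdivrMr ?addr_gt0// ler_peMr ?(ltW (q0 k))// lerDl ltW.
pose u x k : R := (a k * \1_(core w k) x)%R.
have u0 x k : (0 <= u x k)%R by rewrite mulr_ge0 ?(ltW (a0 k))// indicE.
have u_le x k : (u x k <= a k)%R.
  by rewrite /u indicE; case: (_ \in _); rewrite ?mulr1// mulr0 ltW.
pose H x := \sum_(0 <= k <oo) (u x k)%:E.
have H0 x : 0 <= H x by apply: nneseries_ge0 => k _ _; rewrite lee_fin.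
have H1 x : H x <= 1.
  apply: le_trans (epsilon_trick0 xpredT (@ler01 R)).
  apply: lee_nneseries => [k _ _|k _]; rewrite lee_fin//.
  exact: le_trans (u_le x k) (a_le k).
have Hfin x : H x \is a fin_num.
  by rewrite ge0_fin_numE// (le_lt_trans (H1 x))// ltry.
have mu_ k : measurable_fun setT (fun x => (u x k)%:E).
  apply/measurable_EFinP; apply: measurable_funM; first exact: measurable_cst.
  by apply: measurable_indic; exact: measurable_core.
have mH : measurable_fun setT H.
  apply: (@ge0_emeasurable_sum _ _ _ setT (fun k x => (u x k)%:E) xpredT) => k.
    by move=> x _ _; rewrite lee_fin.
  by move=> _; exact: mu_.
have HE : EFin \o (fun x => fine (H x)) = H.
  by apply/funext => x /=; rewrite fineK.
exists (fun x => fine (H x)); split.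
- by apply/measurable_EFinP; rewrite HE; exact: mH.
- by move=> x; exact: fine_ge0.
- apply: filterS (ae_core hw) => x [k ck].
  rewrite -lte_fin fineK//.
  apply: (@lt_le_trans _ _ (\sum_(0 <= i < k.+1) (u x i)%:E)).
    rewrite big_nat_recr//=; apply: (@lt_le_trans _ _ (u x k)%:E).
      by rewrite lte_fin /u indicE mem_set// mulr1.
    by rewrite leeDr// sumEFin lee_fin sumr_ge0.
  by apply: nneseries_lim_ge => i _ _; rewrite lee_fin.
rewrite HE; apply: ge_ereal_sup => _ [g [mg Ng] <-].
rewrite integral_pairingE//.
apply: (@le_trans _ _ (\int[mu]_x \sum_(0 <= k <oo) (`|g x| * `|w x| * (u x k)%:E))).
  apply: ge0_le_integral.
  - exact: measurableT.
  - by move=> x _; rewrite !mule_ge0.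
  - by apply: emeasurable_funM; [exact: mabs|exact: mgw].
  - apply: (@ge0_emeasurable_sum _ _ _ setT
      (fun k x => `|g x| * `|w x| * (u x k)%:E) xpredT) => k.
      by move=> x _ _; rewrite !mule_ge0// lee_fin.
    by move=> _; apply: emeasurable_funM; [exact: mgw|exact: mu_].
  - by move=> x _; rewrite gee0_abs// muleC nneseries_geMl// mule_ge0.
rewrite integral_nneseries.
- apply: le_trans (epsilon_trick0 xpredT (@ler01 R)).
  apply: lee_nneseries => [k _ _|k _].
    by apply: integral_ge0 => x _; rewrite !mule_ge0// lee_fin.
  apply: (@le_trans _ _ (a k * C k)%:E); last by rewrite lee_fin.
  have [Ck CkP] := CP k.
  have -> : \int[mu]_x (`|g x| * `|w x| * (u x k)%:E) =
      (a k)%:E * \int[mu]_(x in core w k) (`|g x| * w x).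
    rewrite [in RHS]integral_mkcond -ge0_integralZl.
    + apply: eq_integral => x _; rewrite /u /patch indicE.
      case: (boolP (x \in core w k)); last by rewrite mulr0 !mule0.
      rewrite inE => /core_gt0 w0; rewrite mulr1 muleC.
      by rewrite (gee0_abs (ltW w0)).
    + exact: measurableT.
    + apply: (measurable_restrictT _ (measurable_core k mw)).1.
      by apply: measurable_funTS; apply: emeasurable_funM; [exact: mabs|exact: mw].
    + move=> x _; rewrite /patch; case: ifPn => //.
      by rewrite inE => /core_gt0 w0; rewrite mule_ge0// ltW.
    + by rewrite lee_fin ltW.
  rewrite (EFinM (a k) (C k)); apply: lee_wpmul2l; first by rewrite lee_fin ltW.
  apply: (le_trans (CkP _ mg)); rewrite -[leRHS]mule1.
  by apply: lee_wpmul2l => //; rewrite lee_fin ltW.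
- exact: measurableT.
- by move=> k; apply: emeasurable_funM; [exact: mgw|exact: mu_].
- by move=> k x _; rewrite !mule_ge0// lee_fin.
Qed.

Lemma hoelder_associate h g : measurable_fun setT h -> measurable_fun setT g ->
  N g < +oo -> \int[mu]_x (`|h x * g x| * w x) <= associate w N h * N g.
Proof.
move=> mh mg Ngy; have Ng0 := BFS_ge0 hN mg.
have [Nz|Nnz] := eqVneq (N g) 0.
  rewrite Nz mule0; have gz := (BFS_eq0 hN mg).1 Nz.
  suff -> : \int[mu]_x (`|h x * g x| * w x) = \int[mu]_(x in setT) 0%E.
    by rewrite integral0.
  apply: ae_eq_integral; first exact: measurableT.
  - by apply: emeasurable_funM; [exact: measurable_absM|exact: mw].
  - exact: measurable_cst.
  by apply: filterS gz => x -> _; rewrite mule0 abse0 mul0e.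
have Nfin : N g \is a fin_num by rewrite ge0_fin_numE.
pose r := fine (N g); have rE : N g = r%:E by rewrite fineK.
have r0 : (0 < r)%R by rewrite -lte_fin -rE lt_neqAle eq_sym Nnz.
pose g' x := r^-1%:E * g x.
have mg' : measurable_fun setT g'.
  by apply: emeasurable_funM; [exact: measurable_cst|exact: mg].
have Ng' : N g' <= 1.
  by rewrite (BFS_scale hN)// rE -EFinM ger0_norm ?invr_ge0 ?(ltW r0)// mulVf ?gt_eqF.
have := integral_associate_le h mg' Ng'.
rewrite integral_pairingE//.
rewrite (_ : (fun x => `|h x| * (`|g' x| * `|w x|)) =
  (fun x => r^-1%:E * (`|h x| * (`|g x| * `|w x|)))); last first.
  apply/funext => x; rewrite /g' abseM (@gee0_abs _ r^-1%:E) ?lee_fin ?invr_ge0 ?(ltW r0)//.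
  by rewrite -muleA; exact: muleCA.
rewrite ge0_integralZl.
- by rewrite -integral_pairingE// lee_pdivrMl// rE muleC.
- exact: measurableT.
- by apply: emeasurable_funM; [exact: mabs|exact: mgw].
- by move=> x _; rewrite !mule_ge0.
- by rewrite lee_fin invr_ge0 ltW.
Qed.

(** The Lorentz-Luxemburg theorem, with test functions that are positive almost
    everywhere. The constant 2 pays for adding the function of
    [positive_associate] to a separating one. *)
Lemma BFS_le_dual f (K : \bar R) : measurable_fun setT f -> 0 <= K ->
  (forall psi : Rn R n -> R, measurable_fun setT psi -> (forall x, (0 <= psi x)%R) ->
    {ae mu, forall x, (0 < psi x)%R} -> associate w N (EFin \o psi) <= 2%:E ->
    \int[mu]_x (`|(psi x)%:E * f x| * w x) <= K) ->
  N f <= K.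
Proof.
move=> mf K0 HK; rewrite leNgt; apply/negP => KN.
have [a [a0 Ka aN]] : exists a : R, [/\ (0 < a)%R, K < a%:E & a%:E < N f].
  case: K K0 KN {HK} => [r| |] // r0; last by rewrite ltNge leey.
  rewrite lee_fin in r0; case: (N f) => [s| |] // rs.
    rewrite lte_fin in rs; exists ((r + s) / 2)%R.
    by split; rewrite ?lte_fin; lra.
  by exists (r + 1)%R; split; rewrite ?lte_fin ?ltry//; lra.
pose f' x := a^-1%:E * f x.
have mf' : measurable_fun setT f'.
  by apply: emeasurable_funM; [exact: measurable_cst|exact: mf].
have Nf' : 1 < N f'.
  rewrite (BFS_scale hN)// ger0_norm ?invr_ge0 ?(ltW a0)//.
  by rewrite lte_pdivlMl// mule1.
have [phi [mphi phi0 aphi aphi1]] := separation hw hN mf' Nf'.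
have [h [mh h0 hpos ah]] := positive_associate.
pose psi x := (phi x + h x)%R.
have mpsi : measurable_fun setT psi by exact: measurable_funD.
have mE (k : Rn R n -> R) : measurable_fun setT k -> measurable_fun setT (EFin \o k).
  by move=> mk; apply/measurable_EFinP; exact: mk.
have psi0 x : (0 <= psi x)%R by rewrite addr_ge0.
have psipos : {ae mu, forall x, (0 < psi x)%R}.
  by apply: filterS hpos => x hx; rewrite ltr_wpDl.
have apsi : associate w N (EFin \o psi) <= 2%:E.
  apply: le_trans (_ : 1 + 1 <= _); last by rewrite -EFinD.
  apply: le_trans (leeD aphi ah).
  rewrite (_ : EFin \o psi = fun x => (EFin \o phi) x + (EFin \o h) x); last first.
    by apply/funext => x; rewrite /= EFinD.
  apply: (@associateD_le (EFin \o phi) (EFin \o h)).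
  - exact: mE.
  - exact: mE.
  - by move=> x; rewrite lee_fin.
  - by move=> x; rewrite lee_fin.
have := HK psi mpsi psi0 psipos apsi; rewrite leNgt => /negP; apply.
apply: (lt_le_trans Ka).
have -> : \int[mu]_x (`|(psi x)%:E * f x| * w x) =
    \int[mu]_x (`|(psi x)%:E| * (`|f x| * `|w x|)).
  exact: (integral_pairingE (mE _ mpsi) mf).
have := aphi1.
have -> : \int[mu]_x (`|(phi x)%:E * f' x| * w x) =
    \int[mu]_x (`|(phi x)%:E| * (`|f' x| * `|w x|)).
  exact: (integral_pairingE (mE _ mphi) mf').
rewrite (_ : (fun x => `|(phi x)%:E| * (`|f' x| * `|w x|)) =
  (fun x => a^-1%:E * (`|(phi x)%:E| * (`|f x| * `|w x|)))); last first.
  apply/funext => x; rewrite /f' abseM (@gee0_abs _ a^-1%:E) ?lee_fin ?invr_ge0 ?(ltW a0)//.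
  by rewrite -muleA; exact: muleCA.
have mphif : measurable_fun setT (fun x => `|(phi x)%:E| * (`|f x| * `|w x|)).
  by apply: emeasurable_funM; [exact: mabs (mE _ mphi)|exact: mgw].
rewrite ge0_integralZl.
- rewrite (lee_pdivlMl _ _ a0) mule1 => h1; apply: (le_trans h1).
  apply: ge0_le_integral.
  + exact: measurableT.
  + by move=> x _; rewrite !mule_ge0.
  + exact: mphif.
  + by apply: emeasurable_funM; [exact: mabs (mE _ mpsi)|exact: mgw].
  + move=> x _; apply: lee_wpmul2r; first by rewrite mule_ge0.
    by rewrite !gee0_abs ?lee_fin// lerDl.
- exact: measurableT.
- exact: mphif.
- by move=> x _; rewrite !mule_ge0.
- by rewrite lee_fin invr_ge0 ltW.
Qed.

End duality.

(** * Extrapolation *)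

Lemma le_poweR {R : realType} (r : R) (x y : \bar R) :
  (0 <= r)%R -> 0 <= x -> x <= y -> x `^ r <= y `^ r.
Proof.
move=> r0 x0 xy; apply: gt0_ler_poweR => //; rewrite in_itv/= leey andbT//.
exact: le_trans xy.
Qed.

Lemma poweRK {R : realType} (r : R) (x : \bar R) :
  r != 0%R -> 0 <= x -> (x `^ r) `^ r^-1 = x.
Proof. by move=> r0 x0; rewrite -poweRrM mulfV// poweRe1. Qed.

Lemma poweRVK {R : realType} (r : R) (x : \bar R) :
  r != 0%R -> 0 <= x -> (x `^ r^-1) `^ r = x.
Proof. by move=> r0 x0; rewrite -poweRrM mulVf// poweRe1. Qed.

Section extrapolation.
Context {R : realType} {n : nat}.
Local Notation mu := (lebesgue R n).
Implicit Types (f g w : Rn R n -> \bar R).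

Lemma measurable_poweR_comp f (p : R) :
  measurable_fun setT f -> measurable_fun setT (fun x => f x `^ p).
Proof. by move=> mf; apply: (measurableT_comp (measurable_poweR p) mf). Qed.

Lemma measurable_abs_poweR f (p : R) :
  measurable_fun setT f -> measurable_fun setT (fun x => `|f x| `^ p).
Proof.
move=> mf; apply: (@measurable_poweR_comp (fun x => `|f x|)).
by apply: measurableT_comp; [exact: abse_measurable|exact: mf].
Qed.

Lemma powernorm_poweR w (N : (Rn R n -> \bar R) -> \bar R) (p : R) f :
  BFS w N -> (0 < p)%R -> measurable_fun setT f ->
  powernorm N p^-1 (fun x => `|f x| `^ p) = N f `^ p.
Proof.
move=> hN p0 mf; rewrite /powernorm invrK (BFS_abs hN mf); congr (N _ `^ p).
by apply/funext => x; rewrite gee0_abs ?poweR_ge0// poweRK// gt_eqF.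
Qed.

Lemma wLnorm_poweR w f (p : R) : (0 < p)%R -> (forall x, 0 <= w x) ->
  wLnorm p w f `^ p = \int[mu]_x (`|f x| `^ p * w x).
Proof.
move=> p0 w0; rewrite /wLnorm poweRVK ?gt_eqF//.
by apply: integral_ge0 => x _; rewrite mule_ge0// poweR_ge0.
Qed.

End extrapolation.

Theorem theorem1p12 (R : realType) (n : nat) (n_gt0 : (0 < n)%N)
    (u v w1 w2 : Rn R n -> \bar R)
    (F : set ((Rn R n -> \bar R) * (Rn R n -> \bar R)))
    (Phi : R -> R)
    (Xu Xv : (Rn R n -> \bar R) -> \bar R) (p0 : R)
    (hu : weight u) (hv : weight v) (hw1 : weight w1) (hw2 : weight w2)
    (hF : extrapolation_family F)
    (hPhi : Young Phi \/ forall t : R, (0 <= t)%R -> Phi t = t)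
    (hXu : BFS u Xu) (hXv : BFS v Xv)
    (hp0 : (0 < p0)%R)
    (hYu : BFS u (powernorm Xu p0^-1)) (hYv : BFS v (powernorm Xv p0^-1))
    (hM : exists C : R, (0 < C)%R /\
      forall f : Rn R n -> \bar R, measurable_fun setT f ->
        associate v (powernorm Xv p0^-1)
          (fun x => maximal Phi f x * w2 x `^ (- p0) * (v x)^-1)
        <= C%:E * associate u (powernorm Xu p0^-1)
                    (fun x => f x * w1 x `^ (- p0) * (u x)^-1))
    (hextra : exists C : R, (0 < C)%R /\
      forall w0 : Rn R n -> \bar R, weight w0 ->
      forall f g, F (f, g) ->
        wLnorm p0 w0 f <= C%:E * wLnorm p0 (maximal Phi w0) g) :
  exists C : R, (0 < C)%R /\
    forall f g, F (f, g) ->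
      Xu (fun x => f x * w1 x) <= C%:E * Xv (fun x => g x * w2 x).
Proof.
have [C1 [C10 hM1]] := hM; have [C2 [C20 hex]] := hextra.
have p0n : p0 != 0%R by rewrite gt_eqF.
pose K : R := (C2 `^ p0 * (C1 * 2))%R.
have K0 : (0 < K)%R by rewrite !mulr_gt0// powR_gt0.
exists (K `^ p0^-1)%R; split; first exact: powR_gt0.
move=> f g Ffg; have [mf mg f0 g0] := hF _ _ Ffg.
have [mu_ upos] := hu; have [mv vpos] := hv.
have [mw1 w1pos] := hw1; have [mw2 w2pos] := hw2.
have mfw : measurable_fun setT (fun x => f x * w1 x) by exact: emeasurable_funM.
have mgw : measurable_fun setT (fun x => g x * w2 x) by exact: emeasurable_funM.
have Xf0 := BFS_ge0 hXu mfw; have Xg0 := BFS_ge0 hXv mgw.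
have [Xgy|Xgy] := eqVneq (Xv (fun x => g x * w2 x)) +oo.
  by rewrite Xgy gt0_muley ?leey// lte_fin powR_gt0.
pose hf x := `|f x * w1 x| `^ p0; pose hg x := `|g x * w2 x| `^ p0.
have mhf : measurable_fun setT hf by exact: measurable_abs_poweR.
have mhg : measurable_fun setT hg by exact: measurable_abs_poweR.
have hfE : powernorm Xu p0^-1 hf = Xu (fun x => f x * w1 x) `^ p0.
  exact: (powernorm_poweR hXu hp0 mfw).
have hgE : powernorm Xv p0^-1 hg = Xv (fun x => g x * w2 x) `^ p0.
  exact: (powernorm_poweR hXv hp0 mgw).
suff main : powernorm Xu p0^-1 hf <= K%:E * powernorm Xv p0^-1 hg.
  rewrite hfE hgE in main.
  rewrite -(poweRK p0n Xf0) -(poweRK p0n Xg0) -poweR_EFin -poweRM ?lee_fin ?(ltW K0) ?poweR_ge0//.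
  by apply: le_poweR => //; rewrite ?invr_ge0 ?(ltW hp0)// poweR_ge0.
have hgy : powernorm Xv p0^-1 hg < +oo.
  by rewrite hgE; apply: poweR_lty; rewrite ltey.
have hg0 : 0 <= powernorm Xv p0^-1 hg := BFS_ge0 hYv mhg.
apply: (BFS_le_dual hu hYu mhf); first by rewrite mule_ge0// lee_fin ltW.
move=> psi mpsi psi0 psipos apsi.
have mEpsi : measurable_fun setT (EFin \o psi) by apply/measurable_EFinP; exact: mpsi.
(* Chosen so that pairing hf with psi against u dx integrates f ^ p0 against w0;
   the absolute value makes w0 nonnegative everywhere. *)
pose w0 x := (psi x)%:E * w1 x `^ p0 * `|u x|.
have w00 x : 0 <= w0 x by rewrite !mule_ge0 ?lee_fin// poweR_ge0.
have mw0 : measurable_fun setT w0.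
  apply: emeasurable_funM.
    by apply: emeasurable_funM; [exact: mEpsi|exact: measurable_poweR_comp].
  by apply: measurableT_comp; [exact: abse_measurable|exact: mu_].
have hw0 : weight w0.
  split; first exact: mw0.
  apply: filterS3 psipos w1pos upos => x px /andP[w1x w1y] /andP[ux uy].
  rewrite /w0 gee0_abs ?(ltW ux)//.
  have pw : 0 < (psi x)%:E * w1 x `^ p0 by rewrite mule_gt0 ?lte_fin// poweR_gt0.
  rewrite mule_gt0//= lte_mul_pinfty ?(ltW pw)//.
  rewrite ge0_fin_numE ?(ltW pw)// lte_mul_pinfty ?lee_fin//.
  exact: poweR_lty.
have LE : \int[lebesgue R n]_x (`|(psi x)%:E * hf x| * u x) =
    \int[lebesgue R n]_x (`|f x| `^ p0 * w0 x).
  apply: ae_eq_integral; first exact: measurableT.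
  - by apply: emeasurable_funM; [exact: (measurable_absM mEpsi mhf)|exact: mu_].
  - by apply: emeasurable_funM; [exact: measurable_abs_poweR|exact: mw0].
  apply: filterS2 w1pos upos => x /andP[w1x _] /andP[ux _] _.
  rewrite /w0 /hf !abseM (gee0_abs (ltW w1x)) (gee0_abs (ltW ux)).
  rewrite (@gee0_abs _ (psi x)%:E) ?lee_fin// (gee0_abs (poweR_ge0 _ _)).
  rewrite poweRM ?abse_ge0 ?(ltW w1x)//.
  by rewrite muleCA -muleA.
rewrite LE -(wLnorm_poweR _ hp0 w00).
have M0 x : 0 <= maximal Phi w0 x by exact: maximal_ge0.
have wL0 w h : 0 <= @wLnorm R n p0 w h by exact: poweR_ge0.
have step1 := le_poweR (ltW hp0) (wL0 _ _) (hex _ hw0 _ _ Ffg).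
apply: (le_trans step1).
rewrite poweRM ?lee_fin ?(ltW C20)// poweR_EFin (wLnorm_poweR _ hp0 M0).
rewrite /K EFinM -muleA; apply: lee_wpmul2l; first by rewrite lee_fin powR_ge0.
pose H x := maximal Phi w0 x * w2 x `^ (- p0) * (v x)^-1.
have mM : measurable_fun setT (maximal Phi w0) by exact: measurable_maximal.
have mH : measurable_fun setT H.
  apply: emeasurable_funM; last exact: measurable_funVe.
  by apply: emeasurable_funM; [exact: mM|exact: measurable_poweR_comp].
have RE : \int[lebesgue R n]_x (`|g x| `^ p0 * maximal Phi w0 x) =
    \int[lebesgue R n]_x (`|H x * hg x| * v x).
  apply: ae_eq_integral; first exact: measurableT.
  - by apply: emeasurable_funM; [exact: measurable_abs_poweR|exact: mM].
  - by apply: emeasurable_funM; [exact: measurable_absM|exact: mv].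
  apply: filterS2 w2pos vpos => x /andP[w2x w2y] /andP[vx vy] _.
  have w2f : w2 x \is a fin_num by rewrite ge0_fin_numE// ltW.
  have vf : v x \is a fin_num by rewrite ge0_fin_numE// ltW.
  rewrite /H /hg (abseM (g x) (w2 x)) (gee0_abs (ltW w2x)) poweRM ?abse_ge0 ?(ltW w2x)//.
  move: (w2 x) (v x) w2f vf w2x vx {w2y vy} => [r| |] // [s| |] // _ _.
  rewrite !lte_fin => r0 s0.
  rewrite inver gt_eqF// !poweR_EFin powRN.
  have rp : (0 < r `^ p0)%R by rewrite powR_gt0.
  set a := `|g x| `^ p0; set m := maximal Phi w0 x.
  have a0 : 0 <= a by exact: poweR_ge0.
  rewrite gee0_abs; last first.
    by rewrite !mule_ge0 ?lee_fin ?invr_ge0 ?(ltW rp) ?(ltW s0)//; exact: M0.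
  rewrite muleAC -(muleA (m * _)) -EFinM mulVf ?gt_eqF// mule1.
  by rewrite (muleC a _%:E) muleA -(muleA m) -EFinM mulVf ?gt_eqF// mule1 muleC.
rewrite RE; apply: (le_trans (hoelder_associate hv hYv mH mhg hgy)).
apply: lee_wpmul2r; first exact: hg0.
apply: (le_trans (hM1 _ mw0)).
rewrite EFinM; apply: lee_wpmul2l; first by rewrite lee_fin ltW.
apply: le_trans apsi.
rewrite (@associate_ae_eq _ _ _ _ hu _ (EFin \o psi)); [exact: lexx| |exact: mEpsi|].
- apply: emeasurable_funM; last exact: measurable_funVe.
  by apply: emeasurable_funM; [exact: mw0|exact: measurable_poweR_comp].
apply: filterS2 w1pos upos => x /andP[w1x w1y] /andP[ux uy].
have w1f : w1 x \is a fin_num by rewrite ge0_fin_numE// ltW.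
have uf : u x \is a fin_num by rewrite ge0_fin_numE// ltW.
rewrite /w0; move: (w1 x) (u x) w1f uf w1x ux {w1y uy} => [r| |] // [s| |] // _ _.
rewrite !lte_fin => r0 s0.
rewrite inver gt_eqF// !poweR_EFin powRN abse_EFin -!EFinM /= (gtr0_norm s0).
by congr EFin; field; rewrite !gt_eqF// powR_gt0.
Qed.
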